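(* Let $\phi$ be a parabolic automorphism of the unit disk $\mathbb{D}$ and let $\nu\in\mathbb{R}$. Then $C_\phi$ is recurrent on $\mathcal{S}_\nu$ if and only if $\nu<1/2$.
   Context: $\mathbb{D}$ is the open unit disk of $\mathbb{C}$. For $\nu\in\mathbb{R}$, the weighted Dirichlet space $\mathcal{S}_\nu$ is the Hilbert space of analytic functions $f(z)=\sum_{n\ge 0}a_nz^n$ on $\mathbb{D}$ with $\|f\|_\nu^2=\sum_{n\ge0}|a_n|^2(n+1)^{2\nu}<\infty$. For a self-map $\phi$ of $\mathbb{D}$, $C_\phi f=f\circ\phi$; it is known that $C_\phi$ is bounded on every $\mathcal{S}_\nu$ when $\phi$ is a linear fractional self-map of $\mathbb{D}$. A bounded linear operator $T$ on a Hilbert space $\mathcal{H}$ is recurrent if for every non-empty open $U\subset\mathcal{H}$ there is a positive integer $n$ with $T^n(U)\cap U\neq\emptyset$. A linear fractional map ($\phi(z)=\frac{az+b}{cz+d}$, $ad-bc\ne0$) other than the identity is parabolic if it has only one fixed point in $\hat{\mathbb{C}}=\mathbb{C}\cup\{\infty\}$; for a self-map of $\mathbb{D}$ this fixed point lies on the unit circle. *)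

(* Defs.v *)
From Stdlib Require Import Reals ClassicalEpsilon FinFun.
From Coquelicot Require Import Coquelicot.
Open Scope R_scope.

Definition disk : Type := {z : C | Cmod z < 1}.
Definition disk_val (z : disk) : C := proj1_sig z.
Coercion disk_val : disk >-> C.

(* [None] is the point at infinity. *)
Definition sphere : Type := option C.

(* The total extension of [z |-> (a z + b) / (c z + d)] to the sphere; it is
   a linear fractional map when [a d - b c <> 0]. *)
Definition mobius (a b c d : C) (w : sphere) : sphere :=
  match w with
  | Some z =>
      if Ceq_dec (c * z + d)%C (RtoC 0) then None
      else Some ((a * z + b) / (c * z + d))%C
  | None => if Ceq_dec c (RtoC 0) then None else Some (a / c)%C
  end.

Definition parabolic (m : sphere -> sphere) : Prop :=
  (exists w : sphere, m w <> w) /\ (exists! w : sphere, m w = w).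

Definition parabolic_automorphism (phi : disk -> disk) : Prop :=
  Bijective phi /\
  exists a b c d : C,
    (a * d - b * c)%C <> RtoC 0 /\
    (forall z : disk, mobius a b c d (Some (z : C)) = Some (phi z : C)) /\
    parabolic (mobius a b c d).

Definition power_expansion (f : disk -> C) (a : nat -> C) : Prop :=
  forall z : disk, @is_pseries C_AbsRing C_NormedModule a (z : C) (f z).

(* Expansions are unique when they exist, so the choice is only arbitrary for
   functions that are not analytic on the disk. *)
Definition coefficients (f : disk -> C) : nat -> C :=
  epsilon (inhabits (fun _ : nat => RtoC 0)) (power_expansion f).

Definition norm_terms (nu : R) (f : disk -> C) (n : nat) : R :=
  Cmod (coefficients f n) ^ 2 * Rpower (INR (n + 1)) (2 * nu).

(* The weighted Dirichlet space S_nu, as a set of functions on the disk. *)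
Definition dirichlet (nu : R) (f : disk -> C) : Prop :=
  (exists a : nat -> C, power_expansion f a) /\ ex_series (norm_terms nu f).

Definition dirichlet_norm (nu : R) (f : disk -> C) : R :=
  sqrt (Series (norm_terms nu f)).

Definition dirichlet_open (nu : R) (U : (disk -> C) -> Prop) : Prop :=
  (forall f, U f -> dirichlet nu f) /\
  (forall f, U f ->
     exists eps : R, 0 < eps /\
       forall g, dirichlet nu g ->
         dirichlet_norm nu (fun z => (g z - f z)%C) < eps -> U g).

Definition composition (phi : disk -> disk) (f : disk -> C) : disk -> C :=
  fun z => f (phi z).

(* [T] is given on all functions on the disk, and stands for its restriction
   to S_nu. *)
Definition recurrent (nu : R) (T : (disk -> C) -> (disk -> C)) : Prop :=
  forall U : (disk -> C) -> Prop,
    dirichlet_open nu U -> (exists f, U f) ->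
    exists n : nat, (0 < n)%nat /\ exists f, U f /\ U (Nat.iter n T f).

(* Main.v *)
Require Import Defs.
From Stdlib Require Import Reals Lra Lia ClassicalEpsilon FunctionalExtensionality.
From Coquelicot Require Import Coquelicot.
Open Scope R_scope.

(* With [alpha] the fixed point of [phi] and [v = 1 / (1 - conj alpha z)], a map of
   the disk onto the half-plane [Re v > 1/2], [phi] becomes a translation
   [v |-> v - i t] with [t] real and non-zero.

   For [nu >= 1/2] the norm dominates the Dirichlet energy, so functions of small
   norm vary little between points at bounded hyperbolic distance.  The pairs
   [phi^n (alpha / 2), phi^n 0] keep their hyperbolic distance, while their
   Euclidean distance is at most [(1/2) / sqrt (1 + t^2)] for [n >= 1]; hence
   functions near the identity function [z] are not brought back near [z].

   For [nu < 1/2] consider the functions [1 / (v + s)] with [s >= 0].  Composing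
   with [phi^n] replaces [s] by [s - i n t], which keeps the Dirichlet energy
   bounded and sends the Hardy norm to [0]; interpolation makes the weighted norm
   tend to [0], along [phi] as well as along its inverse [psi].  Such functions
   span a dense subspace, and if [f] is in their span then [f + f o psi^n] is close
   to [f] and is mapped by the [n]-th iterate to [f o phi^n + f], also close to
   [f]. *)

(** * Complex power series on the disk *)

Lemma pow_n_Cpow (z : C) (n : nat) : @pow_n C_Ring z n = (z ^ n)%C.
Proof. induction n as [|n IH]; simpl; [reflexivity|now rewrite IH]. Qed.

Definition C_sum (c : nat -> C) (n : nat) : C := @sum_n C_AbelianMonoid c n.

Lemma C_sum_O (c : nat -> C) : C_sum c 0 = c O.
Proof. exact (sum_O c). Qed.

Lemma C_sum_S (c : nat -> C) (n : nat) : C_sum c (S n) = (C_sum c n + c (S n))%C.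
Proof. exact (sum_Sn c n). Qed.

Lemma C_is_series_iff (c : nat -> C) (l : C) :
  @is_series C_AbsRing C_NormedModule c l <->
  forall eps : R, 0 < eps -> exists N, forall n, (N <= n)%nat ->
    Cmod (C_sum c n - l)%C < eps.
Proof.
  unfold is_series. split.
  - intros H eps He.
    pose proof (proj1 (@filterlim_locally_ball_norm C_AbsRing nat C_NormedModule
      eventually _ (sum_n c) l) H (mkposreal eps He)) as [N HN].
    exists N. intros n Hn. exact (HN n Hn).
  - intros H.
    apply (proj2 (@filterlim_locally_ball_norm C_AbsRing nat C_NormedModule
      eventually _ (sum_n c) l)).
    intros [eps He]. destruct (H eps He) as [N HN]. exists N.
    intros n Hn. exact (HN n Hn).
Qed.

Lemma power_expansion_iff (f : disk -> C) (a : nat -> C) :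
  power_expansion f a <-> forall z : disk,
    @is_series C_AbsRing C_NormedModule (fun k => a k * (z : C) ^ k)%C (f z).
Proof.
  split; intros H z; specialize (H z).
  - eapply is_series_ext; [|exact H]. intros n. rewrite pow_n_Cpow.
    exact (Cmult_comm _ _).
  - unfold is_pseries. eapply is_series_ext; [|exact H]. intros n.
    rewrite pow_n_Cpow. exact (Cmult_comm _ _).
Qed.

Lemma C_is_series_bound (c : nat -> C) (l : C) (M : R) :
  @is_series C_AbsRing C_NormedModule c l ->
  (forall n, Cmod (C_sum c n) <= M) -> Cmod l <= M.
Proof.
  intros H HM. apply le_epsilon. intros eps He.
  destruct (proj1 (C_is_series_iff c l) H eps He) as [N HN].
  specialize (HN N (Nat.le_refl N)). specialize (HM N).
  replace l with (C_sum c N + - (C_sum c N - l))%C by ring.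
  eapply Rle_trans; [apply Cmod_triangle|]. rewrite Cmod_opp. lra.
Qed.

Lemma C_is_series_geom_remainder (c : nat -> C) (l : C) (K r : R) :
  0 <= r < 1 -> (forall n, Cmod (C_sum c n - l)%C <= K * r ^ n) ->
  @is_series C_AbsRing C_NormedModule c l.
Proof.
  intros Hr H. apply C_is_series_iff. intros eps He.
  assert (HL : is_lim_seq (fun n => K * r ^ n) 0).
  { replace (Finite 0) with (Rbar_mult K 0) by (simpl; f_equal; ring).
    apply is_lim_seq_scal_l, is_lim_seq_geom. rewrite Rabs_pos_eq; lra. }
  apply is_lim_seq_spec in HL. destruct (HL (mkposreal eps He)) as [N HN].
  exists N. intros n Hn. specialize (HN n Hn). simpl in HN.
  eapply Rle_lt_trans; [apply H|]. rewrite Rminus_0_r in HN.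
  eapply Rle_lt_trans; [apply Rle_abs|exact HN].
Qed.

Lemma C_sum_Re (c : nat -> C) (n : nat) :
  Re (C_sum c n) = sum_n (fun k => Re (c k)) n.
Proof.
  induction n as [|n IH]; [now rewrite C_sum_O, sum_O|].
  rewrite C_sum_S, sum_Sn, <- IH. reflexivity.
Qed.

Lemma C_is_series_Re (c : nat -> C) (l : C) :
  @is_series C_AbsRing C_NormedModule c l -> is_series (fun k => Re (c k)) (Re l).
Proof.
  intros H.
  change (is_lim_seq (sum_n (fun k => Re (c k))) (Re l)).
  apply is_lim_seq_spec. intros eps.
  destruct (proj1 (C_is_series_iff c l) H eps (cond_pos eps)) as [N HN].
  exists N. intros n Hn. specialize (HN n Hn).
  rewrite <- C_sum_Re. eapply Rle_lt_trans; [|exact HN].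
  replace (Re _ - Re l) with (Re (C_sum c n - l)%C) by reflexivity.
  apply re_le_Cmod.
Qed.

Lemma C_is_series_scal (x : C) (c : nat -> C) (l : C) :
  @is_series C_AbsRing C_NormedModule c l ->
  @is_series C_AbsRing C_NormedModule (fun k => x * c k)%C (x * l)%C.
Proof. exact (@is_series_scal C_AbsRing C_NormedModule x c l). Qed.

Lemma C_is_series_plus (c d : nat -> C) (l m : C) :
  @is_series C_AbsRing C_NormedModule c l ->
  @is_series C_AbsRing C_NormedModule d m ->
  @is_series C_AbsRing C_NormedModule (fun k => c k + d k)%C (l + m)%C.
Proof. exact (@is_series_plus C_AbsRing C_NormedModule c d l m). Qed.

Definition mk_disk (z : C) (hz : Cmod z < 1) : disk :=
  exist (fun z : C => Cmod z < 1) z hz.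

Definition real_disk (x : R) (hx : Rabs x < 1) : disk :=
  mk_disk x (eq_ind_r (fun r => r < 1) hx (Cmod_R x)).

Lemma PSeries_zero_coeff (a : nat -> R) :
  (forall x, Rabs x < 1 -> is_series (fun k => a k * x ^ k) 0) -> forall n, a n = 0.
Proof.
  intros H n.
  assert (HP : forall x, Rabs x < 1 -> is_pseries a x 0).
  { intros x Hx. apply is_pseries_R, H, Hx. }
  apply (PSeries_ext_recip a (fun _ => 0)).
  (* Convergence at the single point 1/2 already gives a positive radius, since the terms are
     unbounded or do not tend to 0 outside the disk of convergence. *)
  - apply Rbar_lt_le_trans with (Finite (/2)); [simpl; lra|].
    replace (/2) with (Rabs (/2)) by (apply Rabs_pos_eq; lra).
    destruct (Rbar_le_dec (Rabs (/2)) (CV_radius a)) as [?|Hn]; [assumption|].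
    exfalso. apply Rbar_not_le_lt in Hn. apply (CV_disk_outside a (/2) Hn).
    apply ex_series_lim_0. exists 0. apply H. rewrite Rabs_pos_eq; lra.
  - rewrite (CV_radius_const_0). exact I.
  - exists (mkposreal 1 Rlt_0_1). intros x Hx.
    assert (Hx' : Rabs x < 1).
    { change (Rabs (x - 0) < 1) in Hx. now rewrite Rminus_0_r in Hx. }
    rewrite PSeries_const_0. apply is_pseries_unique, HP, Hx'.
Qed.

Lemma power_expansion_scal (x : C) (f : disk -> C) (a : nat -> C) :
  power_expansion f a ->
  power_expansion (fun z => x * f z)%C (fun k => x * a k)%C.
Proof.
  rewrite !power_expansion_iff. intros H z.
  eapply is_series_ext; [|apply (C_is_series_scal x), (H z)].
  intros n. simpl. ring.
Qed.

Lemma power_expansion_plus (f g : disk -> C) (a b : nat -> C) :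
  power_expansion f a -> power_expansion g b ->
  power_expansion (fun z => f z + g z)%C (fun k => a k + b k)%C.
Proof.
  rewrite !power_expansion_iff. intros Hf Hg z.
  eapply is_series_ext; [|apply (C_is_series_plus _ _ _ _ (Hf z) (Hg z))].
  intros n. simpl. ring.
Qed.

Lemma power_expansion_minus (f g : disk -> C) (a b : nat -> C) :
  power_expansion f a -> power_expansion g b ->
  power_expansion (fun z => f z - g z)%C (fun k => a k - b k)%C.
Proof.
  rewrite !power_expansion_iff. intros Hf Hg z.
  replace (f z - g z)%C with (f z + -(1) * g z)%C by ring.
  eapply is_series_ext;
    [|apply (C_is_series_plus _ _ _ _ (Hf z) (C_is_series_scal _ _ _ (Hg z)))].
  intros n. simpl. ring.
Qed.

(** On the real diameter the real parts of the coefficients form a real power series with sum 0. *)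
Lemma power_expansion_zero_Re (a : nat -> C) :
  power_expansion (fun _ => RtoC 0) a -> forall n, Re (a n) = 0.
Proof.
  intros H. apply (PSeries_zero_coeff (fun n => Re (a n))). intros x Hx.
  rewrite power_expansion_iff in H. specialize (H (real_disk x Hx)).
  apply C_is_series_Re in H. eapply is_series_ext; [|exact H].
  intros n. simpl. rewrite <- RtoC_pow. apply re_scal_r.
Qed.

(** Multiplying the difference by [Ci] turns imaginary parts into real parts up to sign, so the
    statement on real parts settles both. *)
Lemma power_expansion_unique (f : disk -> C) (a b : nat -> C) :
  power_expansion f a -> power_expansion f b -> a = b.
Proof.
  intros Ha Hb.
  assert (H0 : power_expansion (fun _ => RtoC 0) (fun k => a k - b k)%C).
  { pose proof (power_expansion_minus _ _ _ _ Ha Hb) as H. intros z.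
    specialize (H z). now replace (RtoC 0) with (f z - f z)%C by ring. }
  assert (H1 : power_expansion (fun _ => RtoC 0) (fun k => Ci * (a k - b k))%C).
  { pose proof (power_expansion_scal Ci _ _ H0) as H. intros z.
    specialize (H z). now replace (RtoC 0) with (Ci * 0)%C by ring. }
  apply functional_extensionality. intros n.
  pose proof (power_expansion_zero_Re _ H0 n) as HR.
  pose proof (power_expansion_zero_Re _ H1 n) as HI.
  unfold Re, Ci, Cmult, Cminus, Cplus, Copp in HR, HI; simpl in HR, HI.
  apply injective_projections; lra.
Qed.

Lemma coefficients_eq (f : disk -> C) (a : nat -> C) :
  power_expansion f a -> coefficients f = a.
Proof.
  intros H. apply power_expansion_unique with f; [|exact H].
  unfold coefficients. apply epsilon_spec. now exists a.
Qed.

(** * Weighted energies of coefficient sequences *)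

Lemma sum_n_le_compat (u v : nat -> R) (n : nat) :
  (forall k, u k <= v k) -> sum_n u n <= sum_n v n.
Proof. intros H. now apply sum_n_m_le. Qed.

Lemma sum_n_nonneg (u : nat -> R) (n : nat) :
  (forall k, 0 <= u k) -> 0 <= sum_n u n.
Proof.
  intros H. induction n as [|n IH].
  - now rewrite sum_O.
  - rewrite sum_Sn. apply Rplus_le_le_0_compat; auto.
Qed.

Lemma sum_n_plus_R (u v : nat -> R) (n : nat) :
  sum_n (fun k => u k + v k) n = sum_n u n + sum_n v n.
Proof. exact (sum_n_plus u v n). Qed.

Lemma sum_n_scal_R (x : R) (u : nat -> R) (n : nat) :
  sum_n (fun k => x * u k) n = x * sum_n u n.
Proof. exact (sum_n_mult_l x u n). Qed.

Lemma sum_Sn_R (u : nat -> R) (n : nat) : sum_n u (S n) = sum_n u n + u (S n).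
Proof. exact (sum_Sn u n). Qed.

Lemma sum_n_incr (u : nat -> R) (n m : nat) :
  (forall k, 0 <= u k) -> (n <= m)%nat -> sum_n u n <= sum_n u m.
Proof.
  intros Hu Hnm. induction Hnm as [|m _ IH]; [lra|].
  rewrite sum_Sn_R. specialize (Hu (S m)). lra.
Qed.

Lemma sum_n_le_is_series (u : nat -> R) (l : R) (n : nat) :
  (forall k, 0 <= u k) -> is_series u l -> sum_n u n <= l.
Proof.
  intros Hu Hl.
  apply (is_lim_seq_incr_compare (sum_n u)); [exact Hl|].
  intros k. rewrite sum_Sn_R. specialize (Hu (S k)). lra.
Qed.

Lemma bounded_sums_ex_series (u : nat -> R) (M : R) :
  (forall k, 0 <= u k) -> (forall n, sum_n u n <= M) ->
  ex_series u /\ Series u <= M.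
Proof.
  intros Hu HM.
  destruct (ex_finite_lim_seq_incr (sum_n u) M) as [l Hl].
  - intros n. rewrite sum_Sn_R. specialize (Hu (S n)). lra.
  - exact HM.
  - split; [now exists l|]. rewrite (is_series_unique u l Hl).
    exact (is_lim_seq_le _ _ l M HM Hl (is_lim_seq_const M)).
Qed.

Definition weight (nu : R) (k : nat) : R := Rpower (INR (k + 1)) (2 * nu).

(** The summand of [norm_terms], taking a coefficient sequence instead of the one chosen for a
    function. *)
Definition energy (nu : R) (a : nat -> C) (k : nat) : R :=
  Cmod (a k) ^ 2 * weight nu k.

(* A bound on the squared norm, phrased so as not to presuppose convergence. *)
Definition energy_le (nu : R) (a : nat -> C) (M : R) : Prop :=
  forall n, sum_n (energy nu a) n <= M.

Lemma weight_pos (nu : R) (k : nat) : 0 < weight nu k.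
Proof. apply exp_pos. Qed.

Lemma energy_nonneg (nu : R) (a : nat -> C) (k : nat) : 0 <= energy nu a k.
Proof.
  apply Rmult_le_pos; [apply pow2_ge_0|apply Rlt_le, weight_pos].
Qed.

Lemma energy_le_trans (nu : R) (a : nat -> C) (M M' : R) :
  energy_le nu a M -> M <= M' -> energy_le nu a M'.
Proof. intros H HM n. eapply Rle_trans; [apply H|exact HM]. Qed.

Lemma energy_le_ext (nu : R) (a b : nat -> C) (M : R) :
  (forall k, a k = b k) -> energy_le nu a M -> energy_le nu b M.
Proof.
  intros H Ha. now replace b with a by now apply functional_extensionality.
Qed.

Lemma Cmod_sqr_triangle (x y : C) :
  Cmod (x + y) ^ 2 <= 2 * Cmod x ^ 2 + 2 * Cmod y ^ 2.
Proof.
  pose proof (Cmod_triangle x y). pose proof (Cmod_ge_0 (x + y)%C).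
  pose proof (Cmod_ge_0 x). pose proof (Cmod_ge_0 y).
  assert (Cmod (x + y) ^ 2 <= (Cmod x + Cmod y) ^ 2) by (apply pow_incr; lra).
  pose proof (pow2_ge_0 (Cmod x - Cmod y)). lra.
Qed.

(** A substitute for the triangle inequality that stays with squared norms, at the cost of a factor
    2. *)
Lemma energy_le_plus (nu : R) (a b : nat -> C) (M M' : R) :
  energy_le nu a M -> energy_le nu b M' ->
  energy_le nu (fun k => a k + b k)%C (2 * M + 2 * M').
Proof.
  intros Ha Hb n. specialize (Ha n). specialize (Hb n).
  apply Rle_trans with
    (sum_n (fun k => 2 * energy nu a k + 2 * energy nu b k) n).
  - apply sum_n_le_compat. intros k. unfold energy.
    pose proof (Cmod_sqr_triangle (a k) (b k)). pose proof (weight_pos nu k). nra.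
  - rewrite sum_n_plus_R, !sum_n_scal_R. lra.
Qed.

Lemma energy_le_scal (nu : R) (x : C) (a : nat -> C) (M : R) :
  energy_le nu a M -> energy_le nu (fun k => x * a k)%C (Cmod x ^ 2 * M).
Proof.
  intros Ha n. specialize (Ha n).
  apply Rle_trans with (sum_n (fun k => Cmod x ^ 2 * energy nu a k) n).
  - apply sum_n_le_compat. intros k. unfold energy. rewrite Cmod_mult. lra.
  - rewrite sum_n_scal_R. apply Rmult_le_compat_l; [apply pow2_ge_0|exact Ha].
Qed.

Lemma energy_le_minus (nu : R) (a b : nat -> C) (M M' : R) :
  energy_le nu a M -> energy_le nu b M' ->
  energy_le nu (fun k => a k - b k)%C (2 * M + 2 * M').
Proof.
  intros Ha Hb. apply (energy_le_scal nu (-(1))%C) in Hb.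
  rewrite Cmod_m1 in Hb. replace (1 ^ 2 * M') with M' in Hb by ring.
  apply (energy_le_ext nu (fun k => a k + -(1) * b k)%C); [intros k; ring|].
  now apply energy_le_plus.
Qed.

Lemma energy_le_dirichlet (nu : R) (f : disk -> C) (a : nat -> C) (M : R) :
  power_expansion f a -> energy_le nu a M ->
  dirichlet nu f /\ dirichlet_norm nu f <= sqrt M.
Proof.
  intros Hf HM. unfold dirichlet, dirichlet_norm, norm_terms.
  rewrite (coefficients_eq f a Hf).
  destruct (bounded_sums_ex_series (energy nu a) M (energy_nonneg nu a) HM)
    as [Hex HS].
  split; [split; [now exists a|exact Hex]|]. apply sqrt_le_1_alt, HS.
Qed.

Lemma dirichlet_energy_le (nu : R) (f : disk -> C) (a : nat -> C) :
  power_expansion f a -> dirichlet nu f ->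
  is_series (energy nu a) (dirichlet_norm nu f ^ 2).
Proof.
  unfold dirichlet, dirichlet_norm, norm_terms. intros Hf [_ Hex].
  rewrite (coefficients_eq f a Hf) in *.
  change (ex_series (energy nu a)) in Hex.
  change (is_series (energy nu a) (sqrt (Series (energy nu a)) ^ 2)).
  apply Series_correct in Hex. rewrite pow2_sqrt; [exact Hex|].
  eapply Rle_trans; [apply (energy_nonneg nu a 0)|].
  rewrite <- (sum_O (energy nu a)).
  apply sum_n_le_is_series; [apply energy_nonneg|exact Hex].
Qed.

(** The exponent [2 * nu] is at least 1 here, so the norm controls the Dirichlet integral. *)
Lemma weight_ge_linear (nu : R) (k : nat) : 1 / 2 <= nu -> INR (k + 1) <= weight nu k.
Proof.
  intros Hnu. unfold weight.
  assert (Hk : 1 <= INR (k + 1)) by (rewrite plus_INR; pose proof (pos_INR k); simpl; lra).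
  rewrite <- (Rpower_1 (INR (k + 1))) at 1; [|lra].
  destruct (Req_dec (INR (k + 1)) 1) as [E|E].
  - rewrite E. unfold Rpower. rewrite ln_1, !Rmult_0_r. lra.
  - apply Rle_Rpower; lra.
Qed.

Lemma exp_le_compat (x y : R) : x <= y -> exp x <= exp y.
Proof.
  intros [H| ->]; [now apply Rlt_le, exp_increasing|apply Rle_refl].
Qed.

(** Interpolation between the Dirichlet weight, with an arbitrarily small factor, and the constant
    Hardy weight. With [p = 2 nu < 1], the factor [x^(p-1)] of [x^p] is at most [eps] from
    [X = eps^(1/(p-1))] on, and below [X] the weight is bounded. *)
Lemma weight_sublinear (nu : R) : nu < 1 / 2 ->
  forall eps, 0 < eps -> exists K, 0 < K /\
    forall k, weight nu k <= eps * INR (k + 1) + K.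
Proof.
  intros Hnu eps He. set (p := 2 * nu).
  assert (Hp : p < 1) by (unfold p; lra).
  set (X := Rpower eps (/ (p - 1))).
  assert (HX : 0 < X) by apply exp_pos.
  assert (HXe : Rpower X (p - 1) = eps).
  { unfold X. rewrite Rpower_mult, Rinv_l; [now apply Rpower_1|lra]. }
  pose proof (exp_pos (p * ln X)) as HXp. change (0 < Rpower X p) in HXp.
  (* For [x < X], the summand 1 serves [p <= 0] and the power of [X] serves [p > 0]. *)
  exists (1 + Rpower X p). split; [lra|]. intros k.
  unfold weight. fold p. set (x := INR (k + 1)).
  assert (Hx : 1 <= x).
  { unfold x. rewrite plus_INR. pose proof (pos_INR k). simpl. lra. }
  assert (Hex : 0 <= eps * x) by nra.
  assert (Hln : 0 <= ln x) by (rewrite <- ln_1; apply ln_le; lra).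
  destruct (Rle_lt_dec X x) as [HXx|HXx].
  - replace p with (1 + (p - 1)) at 1 by ring.
    rewrite Rpower_plus, Rpower_1; [|lra].
    assert (Rpower x (p - 1) <= eps).
    { rewrite <- HXe. unfold Rpower. apply exp_le_compat.
      pose proof (ln_le X x HX HXx). nra. }
    nra.
  - destruct (Rle_lt_dec p 0) as [Hp0|Hp0].
    + assert (Rpower x p <= 1); [|lra]. unfold Rpower. rewrite <- exp_0.
      apply exp_le_compat. nra.
    + assert (Rpower x p <= Rpower X p); [|lra].
      apply Rle_Rpower_l; lra.
Qed.

(** * Parabolic automorphisms as translations of a half-plane *)

Lemma disk_lt_1 (z : disk) : Cmod z < 1.
Proof. exact (proj2_sig z). Qed.

Lemma disk_zero_lt : Cmod 0 < 1.
Proof. rewrite Cmod_0. lra. Qed.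

Definition disk_zero : disk := mk_disk 0 disk_zero_lt.

Lemma Cmult_reg_r (x y z : C) : z <> 0 -> (x * z = y * z)%C -> x = y.
Proof.
  intros Hz H. replace x with (x * z / z)%C by (field; exact Hz).
  rewrite H. field. exact Hz.
Qed.

Lemma archimed_nat (x y : R) : 0 < x -> exists n, y < INR n * x.
Proof.
  intros Hx. destruct (nfloor_ex (Rmax 0 (y / x)) (Rmax_l _ _)) as [n [_ Hn]].
  exists (S n). rewrite S_INR. pose proof (Rmax_r 0 (y / x)).
  apply Rmult_lt_reg_r with (/ x); [now apply Rinv_0_lt_compat|].
  rewrite Rmult_assoc, Rinv_r; [|lra]. unfold Rdiv in *. lra.
Qed.

(** The orbit of 0 is [n e], which would leave the disk if [e] were not 0. *)
Lemma no_disk_translation (phi : disk -> disk) (e : C) :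
  (forall z, (phi z : C) = z + e)%C -> e = 0.
Proof.
  intros H. apply Cmod_eq_0. apply Rle_antisym; [|apply Cmod_ge_0].
  apply Rnot_lt_le. intros He.
  assert (Hn : forall n, (Nat.iter n phi disk_zero : C) = (INR n * e)%C).
  { induction n as [|n IH]; [simpl; ring|].
    rewrite Nat.iter_succ, H, IH, S_INR, RtoC_plus. ring. }
  destruct (archimed_nat (Cmod e) 1 He) as [n Hn1].
  pose proof (disk_lt_1 (Nat.iter n phi disk_zero)) as Hlt.
  rewrite Hn, Cmod_mult, Cmod_R, Rabs_pos_eq in Hlt; [lra|apply pos_INR].
Qed.

(* In terms of [w = 1 / (z - alpha)] the conclusion says that the map is the
   translation [w |-> w + kappa]. *)
Lemma parabolic_translation (phi : disk -> disk) (a b c d : C) :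
  (a * d - b * c)%C <> 0 ->
  (forall z : disk, mobius a b c d (Some (z : C)) = Some (phi z : C)) ->
  parabolic (mobius a b c d) ->
  exists alpha kappa : C, kappa <> 0 /\
    forall z : disk, ((phi z - alpha) * (1 + kappa * (z - alpha)) = z - alpha)%C.
Proof.
  intros Hdet Hphi [[w0 Hw0] [w [Hw Huniq]]].
  assert (Hval : forall z : disk, (c * z + d)%C <> 0 /\
                   (phi z * (c * z + d) = a * z + b)%C).
  { intros z. specialize (Hphi z). simpl in Hphi.
    destruct (Ceq_dec (c * z + d)%C 0) as [E|E]; [discriminate|].
    injection Hphi as Hphi. split; [exact E|]. rewrite <- Hphi. field. exact E. }
  (* If [c = 0], the map fixes infinity and is affine. Having no finite fixed point besides, it is a
     translation or the identity; a translation does not preserve the disk, and the identity is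
     excluded. *)
  destruct (Ceq_dec c 0) as [Hc|Hc].
  - exfalso. subst c.
    assert (Hd : d <> 0) by (intros ->; apply Hdet; ring).
    assert (Ha : a <> 0) by (intros ->; apply Hdet; ring).
    assert (Hinf : mobius a b 0 d None = None).
    { simpl. destruct (Ceq_dec 0 0); congruence. }
    assert (Hwinf : w = None) by now apply Huniq.
    assert (Hfin : forall z, mobius a b 0 d (Some z) = Some ((a * z + b) / d)%C).
    { intros z. simpl. replace (0 * z + d)%C with d by ring.
      destruct (Ceq_dec d 0); congruence. }
    assert (Had : a = d).
    { destruct (Ceq_dec a d) as [E|E]; [exact E|]. exfalso.
      assert (HE : (d - a)%C <> 0).
      { apply Cminus_eq_contra. congruence. }
      specialize (Huniq (Some (b / (d - a))%C)).
      rewrite Hwinf in Huniq. discriminate Huniq. rewrite Hfin. f_equal.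
      field. now split. }
    subst d.
    assert (Hb : (b / a)%C = 0).
    { apply (no_disk_translation phi). intros z.
      destruct (Hval z) as [_ Hz].
      replace (z + b / a)%C with ((a * z + b) / a)%C by (field; exact Ha).
      rewrite <- Hz. field. exact Ha. }
    apply Hw0. destruct w0 as [z|]; [|exact Hinf].
    rewrite Hfin. f_equal.
    replace ((a * z + b) / a)%C with (z + b / a)%C by (field; exact Ha).
    rewrite Hb. ring.
  - destruct w as [al|].
    2:{ exfalso. simpl in Hw. destruct (Ceq_dec c 0); congruence. }
    simpl in Hw. destruct (Ceq_dec (c * al + d)%C 0) as [E|E]; [discriminate|].
    injection Hw as Hw.
    assert (Hw' : (a * al + b = al * (c * al + d))%C).
    { rewrite <- Hw at 2. field. exact E. }
    assert (Hb : (b = al * (c * al + d) - a * al)%C) by (rewrite <- Hw'; ring).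
    (* The second root of the fixed point equation, which has to coincide
       with [al]. *)
    set (be := ((a - d) / c - al)%C).
    assert (Hbe : (c * be + d = a - c * al)%C) by (unfold be; field; exact Hc).
    assert (Hbe0 : (c * be + d)%C <> 0).
    { rewrite Hbe. intros H0. apply Hdet. rewrite Hb.
      replace a with (c * al)%C.
      - ring.
      - replace a with ((a - c * al) + c * al)%C by ring. rewrite H0. ring. }
    assert (Heq : Some al = Some be).
    { apply Huniq. simpl. destruct (Ceq_dec (c * be + d)%C 0); [contradiction|].
      f_equal. apply Cmult_reg_r with (c * be + d)%C; [exact Hbe0|].
      unfold Cdiv. rewrite <- Cmult_assoc, Cinv_l, Cmult_1_r; [|exact Hbe0].
      rewrite Hb. unfold be. field. exact Hc. }
    injection Heq as Heq.
    set (D := (c * al + d)%C) in *.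
    assert (Ha : (a = D + c * al)%C).
    { replace a with ((a - d) / c * c + d)%C by (field; exact Hc).
      replace ((a - d) / c)%C with (be + al)%C by (unfold be; ring).
      rewrite <- Heq. unfold D. ring. }
    (* With [a = D + c al] and [d = D - c al] the map satisfies [phi z - al = D (z - al) / (D + c (z
       - al))]; taking reciprocals adds [c / D]. *)
    exists al, (c / D)%C. split.
    + intros H0. apply Hc. replace c with (c / D * D)%C by (field; exact E).
      rewrite H0. ring.
    + intros z. destruct (Hval z) as [Hz0 Hz].
      assert (Hd : (d = D - c * al)%C) by (unfold D; ring).
      clearbody D be.
      rewrite Hb, Ha, Hd in Hz. rewrite Hd in Hz0.
      assert (Hphiz : (phi z : C) = (((D + c * al) * z + (al * D - (D + c * al) * al)) / (c * z + (D - c * al)))%C).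
      { rewrite <- Hz. field. exact Hz0. }
      rewrite Hphiz. field. split; assumption.
Qed.

(** If [alpha] were inside the disk, so would be [alpha + 1 / (n kappa)] for large [n]; but going
    back [n] times with [psi] from this point leads to infinity. *)
Lemma fixed_point_Cmod_ge_1 (phi psi : disk -> disk) (alpha kappa : C) :
  (forall z, phi (psi z) = z) -> kappa <> 0 ->
  (forall z : disk, ((phi z - alpha) * (1 + kappa * (z - alpha)) = z - alpha)%C) ->
  1 <= Cmod alpha.
Proof.
  intros Hpsi Hk Hphi. apply Rnot_lt_le. intros Hal.
  (* [w = n kappa] would be an [n]-th forward image of [w = 0], that is of
     [z = infinity]. *)
  assert (Hn : forall (n : nat) (z : disk), ((z - alpha) * (INR n * kappa))%C <> 1).
  { induction n as [|n IH]; intros z Hz.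
    - apply C1_nz. rewrite <- Hz. simpl. ring.
    - apply (IH (psi z)). specialize (Hphi (psi z)). rewrite Hpsi in Hphi.
      rewrite S_INR, RtoC_plus in Hz.
      replace ((psi z - alpha) * (INR n * kappa))%C
        with ((psi z - alpha) * ((INR n + 1) * kappa) - kappa * (psi z - alpha))%C by ring.
      rewrite <- Hphi at 1.
      replace ((z - alpha) * (1 + kappa * (psi z - alpha)) * ((INR n + 1) * kappa))%C
        with ((z - alpha) * ((INR n + 1) * kappa) * (1 + kappa * (psi z - alpha)))%C by ring.
      rewrite Hz. ring. }
  pose proof (proj1 (Cmod_gt_0 kappa) Hk) as Hk0.
  assert (Hak : 0 < (1 - Cmod alpha) * Cmod kappa) by (apply Rmult_lt_0_compat; lra).
  destruct (archimed_nat ((1 - Cmod alpha) * Cmod kappa) 1 Hak) as [n Hn1].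
  assert (Hn0 : 0 < INR n).
  { destruct (Rle_lt_dec (INR n) 0); [nra|assumption]. }
  assert (HnC : RtoC (INR n) <> 0) by (intros H; apply RtoC_inj in H; lra).
  assert (Hz : Cmod (alpha + / (INR n * kappa)) < 1).
  { eapply Rle_lt_trans; [apply Cmod_triangle|].
    rewrite Cmod_inv; [|now apply Cmult_neq_0].
    rewrite Cmod_mult, Cmod_R, Rabs_pos_eq; [|lra].
    assert (/ (INR n * Cmod kappa) < 1 - Cmod alpha); [|lra].
    apply Rmult_lt_reg_l with (INR n * Cmod kappa); [nra|].
    rewrite Rinv_r; [lra|nra]. }
  apply (Hn n (mk_disk _ Hz)). simpl. field. now split.
Qed.

(** Along the orbit of 0, [w = n kappa - 1 / alpha] is unbounded, so the orbit comes arbitrarily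
    close to [alpha]; a point outside the closed disk keeps distance at least [|alpha| - 1] from
    it. *)
Lemma fixed_point_Cmod_le_1 (phi : disk -> disk) (alpha kappa : C) :
  kappa <> 0 ->
  (forall z : disk, ((phi z - alpha) * (1 + kappa * (z - alpha)) = z - alpha)%C) ->
  Cmod alpha <= 1.
Proof.
  intros Hk Hphi. apply Rnot_lt_le. intros Hal.
  assert (Hal0 : alpha <> 0) by (intros ->; rewrite Cmod_0 in Hal; lra).
  assert (Hn : forall n, ((Nat.iter n phi disk_zero - alpha) *
                          (INR n * kappa - / alpha) = 1)%C).
  { induction n as [|n IH]; [simpl; field; exact Hal0|].
    rewrite Nat.iter_succ, S_INR, RtoC_plus.
    set (z := Nat.iter n phi disk_zero) in *.
    replace ((INR n + 1) * kappa - / alpha)%C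
      with ((INR n * kappa - / alpha) + kappa * 1)%C by ring.
    rewrite <- IH at 1.
    replace ((phi z - alpha) * (INR n * kappa - / alpha +
             kappa * ((z - alpha) * (INR n * kappa - / alpha))))%C
      with ((phi z - alpha) * (1 + kappa * (z - alpha)) *
            (INR n * kappa - / alpha))%C by ring.
    now rewrite Hphi. }
  pose proof (proj1 (Cmod_gt_0 kappa) Hk) as Hk0.
  destruct (archimed_nat (Cmod kappa) (/ (Cmod alpha - 1) + Cmod (/ alpha)) Hk0)
    as [n Hn1].
  specialize (Hn n). pose proof (disk_lt_1 (Nat.iter n phi disk_zero)) as Hz.
  set (z := Nat.iter n phi disk_zero) in *.
  assert (H1 : Cmod alpha - 1 <= Cmod (z - alpha)).
  { pose proof (Cmod_triangle z (- (z - alpha))) as H.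
    replace (z + - (z - alpha))%C with alpha in H by ring.
    rewrite Cmod_opp in H. lra. }
  assert (H2 : / (Cmod alpha - 1) < Cmod (INR n * kappa - / alpha)).
  { pose proof (Cmod_triangle (INR n * kappa - / alpha) (/ alpha)) as H.
    replace (INR n * kappa - / alpha + / alpha)%C with (INR n * kappa)%C in H by ring.
    rewrite Cmod_mult, Cmod_R, (Rabs_pos_eq (INR n)) in H; [lra|apply pos_INR]. }
  apply (f_equal Cmod) in Hn. rewrite Cmod_mult, Cmod_1 in Hn.
  assert (0 < / (Cmod alpha - 1)) by (apply Rinv_0_lt_compat; lra).
  assert ((Cmod alpha - 1) * / (Cmod alpha - 1) = 1) by (apply Rinv_r; lra).
  nra.
Qed.

(* For [alpha] on the unit circle this maps the disk onto the half-plane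
   [Re v > 1/2] and [alpha] to infinity. *)
Definition cayley (alpha z : C) : C := (/ (1 - Cconj alpha * z))%C.

(** The real part is [(1 - Re w) / |1 - w|^2], and [2 (1 - Re w) - |1 - w|^2 = 1 - |w|^2]. *)
Lemma Re_Cinv_1_minus (w : C) : Cmod w < 1 -> 1 / 2 < Re (/ (1 - w))%C.
Proof.
  intros H. destruct w as [x y].
  assert (Hxy : x ^ 2 + y ^ 2 < 1).
  { pose proof (Cmod2_alt (x, y)) as E. simpl Re in E. simpl Im in E.
    rewrite <- E. pose proof (Cmod_ge_0 (x, y)). nra. }
  simpl. apply Rmult_lt_reg_r with ((1 + - x) ^ 2 + (0 + - y) ^ 2); [nra|].
  unfold Rdiv. rewrite !Rmult_assoc, Rinv_l; nra.
Qed.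

Lemma Cconj_unit (alpha : C) :
  Cmod alpha = 1 -> (Cconj alpha * alpha)%C = 1.
Proof.
  intros alpha_unit. rewrite Cmult_comm, <- Cmod2_conj, alpha_unit. f_equal. ring.
Qed.

Lemma Cmod_Cconj_unit_mult (alpha z : C) :
  Cmod alpha = 1 -> Cmod (Cconj alpha * z) = Cmod z.
Proof. intros alpha_unit. rewrite Cmod_mult, Cmod_conj, alpha_unit. ring. Qed.

Lemma cayley_denominator (alpha : C) (z : disk) :
  Cmod alpha = 1 -> (1 - Cconj alpha * z)%C <> 0.
Proof.
  intros alpha_unit H. pose proof (disk_lt_1 z) as Hz.
  rewrite <- (Cmod_Cconj_unit_mult alpha) in Hz; [|exact alpha_unit].
  replace (Cconj alpha * z)%C with (1 - (1 - Cconj alpha * z))%C in Hz by ring.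
  rewrite H in Hz. replace (1 - 0)%C with (RtoC 1) in Hz by ring.
  rewrite Cmod_1 in Hz. lra.
Qed.

Lemma Re_cayley (alpha : C) (z : disk) :
  Cmod alpha = 1 -> 1 / 2 < Re (cayley alpha z).
Proof.
  intros alpha_unit. apply Re_Cinv_1_minus.
  rewrite Cmod_Cconj_unit_mult by exact alpha_unit. apply disk_lt_1.
Qed.

(** For unimodular [alpha] the Cayley coordinate is [v = - alpha w] with [w = 1 / (z - alpha)], so
    adding [kappa] to [w] subtracts [alpha kappa] from [v]. *)
Lemma cayley_translation (alpha kappa : C) (phi : disk -> disk) :
  Cmod alpha = 1 ->
  (forall z : disk, ((phi z - alpha) * (1 + kappa * (z - alpha)) = z - alpha)%C) ->
  forall z : disk, (cayley alpha (phi z) = cayley alpha z - alpha * kappa)%C.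
Proof.
  intros alpha_unit Hphi z. specialize (Hphi z).
  pose proof (cayley_denominator alpha z alpha_unit) as Hz.
  pose proof (cayley_denominator alpha (phi z) alpha_unit) as Hp. unfold cayley.
  assert (E : ((1 - Cconj alpha * phi z) *
    (1 - alpha * kappa * (1 - Cconj alpha * z)) = 1 - Cconj alpha * z)%C).
  { replace (1 - Cconj alpha * z)%C with (- Cconj alpha * (z - alpha))%C
      by (rewrite <- (Cconj_unit alpha alpha_unit); ring).
    replace (1 - Cconj alpha * phi z)%C with (- Cconj alpha * (phi z - alpha))%C
      by (rewrite <- (Cconj_unit alpha alpha_unit); ring).
    rewrite <- Hphi at 2.
    replace (alpha * kappa * (- Cconj alpha * (z - alpha)))%C
      with (- (Cconj alpha * alpha) * (kappa * (z - alpha)))%C by ring.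
    rewrite Cconj_unit by exact alpha_unit. ring. }
  apply Cmult_reg_r with (1 - Cconj alpha * z)%C; [exact Hz|].
  rewrite <- E at 1. field. now split.
Qed.

Lemma cayley_iter (alpha tau : C) (phi : disk -> disk) :
  (forall z : disk, (cayley alpha (phi z) = cayley alpha z - tau)%C) ->
  forall n (z : disk),
    (cayley alpha (Nat.iter n phi z) = cayley alpha z - INR n * tau)%C.
Proof.
  intros H n z. induction n as [|n IH]; [simpl; ring|].
  rewrite Nat.iter_succ, H, IH, S_INR, RtoC_plus. ring.
Qed.

(** Otherwise repeated subtraction of [tau] would leave the half-plane [Re v > 1/2]. *)
Lemma cayley_translation_Re (alpha tau : C) (phi : disk -> disk) :
  Cmod alpha = 1 ->
  (forall z : disk, (cayley alpha (phi z) = cayley alpha z - tau)%C) -> Re tau <= 0.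
Proof.
  intros alpha_unit H. apply Rnot_lt_le. intros Ht.
  destruct (archimed_nat (Re tau) (Re (cayley alpha disk_zero)) Ht) as [n Hn].
  pose proof (Re_cayley alpha (Nat.iter n phi disk_zero) alpha_unit) as Hre.
  rewrite (cayley_iter alpha tau phi H) in Hre.
  assert (E : Re (cayley alpha disk_zero - INR n * tau)
    = Re (cayley alpha disk_zero) - INR n * Re tau).
  { rewrite <- re_scal_l. reflexivity. }
  lra.
Qed.

(** The map and its inverse translate the half-plane into itself by opposite vectors, so the
    translation is parallel to the boundary line, that is, purely imaginary. *)
Lemma parabolic_automorphism_normal_form (phi : disk -> disk) :
  parabolic_automorphism phi ->
  exists (psi : disk -> disk) (alpha : C) (t : R),
    (forall z, phi (psi z) = z) /\ (forall z, psi (phi z) = z) /\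
    Cmod alpha = 1 /\ t <> 0 /\
    forall z : disk, (cayley alpha (phi z) = cayley alpha z - t * Ci)%C.
Proof.
  intros [[psi [Hl Hr]] [a [b [c [d [Hdet [Hphi Hpar]]]]]]].
  destruct (parabolic_translation phi a b c d Hdet Hphi Hpar)
    as [alpha [kappa [Hk Hak]]].
  assert (Hal : Cmod alpha = 1).
  { apply Rle_antisym.
    - exact (fixed_point_Cmod_le_1 phi alpha kappa Hk Hak).
    - exact (fixed_point_Cmod_ge_1 phi psi alpha kappa Hr Hk Hak). }
  pose proof (cayley_translation alpha kappa phi Hal Hak) as Htr.
  set (tau := (alpha * kappa)%C) in *.
  assert (Htau : tau <> 0).
  { apply Cmult_neq_0; [|exact Hk]. intros ->. rewrite Cmod_0 in Hal. lra. }
  assert (H1 : Re tau <= 0) by exact (cayley_translation_Re alpha tau phi Hal Htr).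
  assert (H2 : Re (- tau) <= 0).
  { apply (cayley_translation_Re alpha _ psi Hal). intros z.
    rewrite <- (Hr z) at 2. rewrite Htr. ring. }
  change (Re (- tau)) with (- Re tau) in H2.
  assert (E : tau = (Im tau * Ci)%C).
  { apply injective_projections.
    - change (Re tau = Im tau * 0 - 0 * 1). lra.
    - change (Im tau = Im tau * 1 + 0 * 0). ring. }
  exists psi, alpha, (Im tau). repeat split; try assumption.
  - intros H. apply Htau. rewrite E, H. ring.
  - rewrite <- E. exact Htr.
Qed.

(** * The case [nu >= 1/2] *)

Lemma dirichlet_energy_bound (nu : R) (f : disk -> C) (a : nat -> C) :
  power_expansion f a -> dirichlet nu f -> energy_le nu a (dirichlet_norm nu f ^ 2).
Proof.
  intros Hf Hd n. apply sum_n_le_is_series; [apply energy_nonneg|].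
  now apply dirichlet_energy_le.
Qed.

Lemma dirichlet_minus (nu : R) (f g : disk -> C) :
  dirichlet nu f -> dirichlet nu g -> dirichlet nu (fun z => f z - g z)%C.
Proof.
  intros Hf Hg. pose proof Hf as [[a Ha] _]. pose proof Hg as [[b Hb] _].
  apply (energy_le_dirichlet nu _ (fun k => a k - b k)%C
    (2 * dirichlet_norm nu f ^ 2 + 2 * dirichlet_norm nu g ^ 2)).
  - now apply power_expansion_minus.
  - apply energy_le_minus; now apply dirichlet_energy_bound.
Qed.

Lemma dirichlet_norm_nonneg (nu : R) (f : disk -> C) : 0 <= dirichlet_norm nu f.
Proof. apply sqrt_pos. Qed.

(** * A Lipschitz estimate for functions of finite Dirichlet energy *)

Lemma Cmod_pow_minus_le (z w : C) (r : R) (n : nat) :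
  Cmod z <= r -> Cmod w <= r ->
  Cmod (z ^ S n - w ^ S n)%C <= INR (n + 1) * Cmod (z - w) * r ^ n.
Proof.
  intros Hz Hw. pose proof (Cmod_ge_0 z) as Hz0.
  induction n as [|n IH].
  - simpl. replace (z * 1 - w * 1)%C with (z - w)%C by ring. lra.
  - replace (z ^ S (S n) - w ^ S (S n))%C
      with (z * (z ^ S n - w ^ S n) + (z - w) * w ^ S n)%C by (simpl; ring).
    eapply Rle_trans; [apply Cmod_triangle|]. rewrite !Cmod_mult, Cmod_pow.
    replace (S n + 1)%nat with (S (n + 1)) by lia. rewrite S_INR.
    replace ((INR (n + 1) + 1) * Cmod (z - w) * r ^ S n)
      with (r * (INR (n + 1) * Cmod (z - w) * r ^ n) + Cmod (z - w) * r ^ S n)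
      by (simpl; ring).
    apply Rplus_le_compat.
    + apply Rmult_le_compat; auto using Cmod_ge_0.
    + apply Rmult_le_compat_l; [apply Cmod_ge_0|].
      apply pow_incr. split; [apply Cmod_ge_0|exact Hw].
Qed.

(** Partial sums of the derivative of the geometric series, whose total is [1 / (1 - q)^2]. *)
Lemma sum_n_arith_geom (q : R) (n : nat) :
  sum_n (fun k => INR (k + 1) * q ^ k) n * (1 - q) ^ 2
  = 1 - INR (n + 2) * q ^ (n + 1) + INR (n + 1) * q ^ (n + 2).
Proof.
  induction n as [|n IH]; [rewrite sum_O; simpl; ring|].
  rewrite sum_Sn_R, Rmult_plus_distr_r, IH.
  rewrite !plus_INR, !S_INR, !pow_add, <- !tech_pow_Rmult. simpl. ring.
Qed.

Lemma sum_n_arith_geom_le (q : R) (n : nat) : 0 <= q < 1 ->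
  sum_n (fun k => INR (k + 1) * q ^ k) n * (1 - q) ^ 2 <= 1.
Proof.
  intros Hq. rewrite sum_n_arith_geom.
  replace (n + 2)%nat with (S (n + 1)) by lia. rewrite S_INR, <- tech_pow_Rmult.
  pose proof (pos_INR (n + 1)). pose proof (pow_le q (n + 1) (proj1 Hq)).
  assert (0 <= INR (n + 1) * q ^ (n + 1) * (1 - q)).
  { apply Rmult_le_pos; [now apply Rmult_le_pos|lra]. }
  lra.
Qed.

Lemma sum_n_shift (u : nat -> R) (n : nat) :
  sum_n (fun k => match k with O => 0 | S m => u m end) (S n) = sum_n u n.
Proof.
  induction n as [|n IH].
  - rewrite sum_Sn_R, !sum_O. apply Rplus_0_l.
  - rewrite sum_Sn_R, IH, sum_Sn_R. reflexivity.
Qed.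

Lemma Cmod_C_sum_le (c : nat -> C) (n : nat) :
  Cmod (C_sum c n) <= sum_n (fun k => Cmod (c k)) n.
Proof.
  induction n as [|n IH]; [rewrite C_sum_O, sum_O; apply Rle_refl|].
  rewrite C_sum_S, sum_Sn. eapply Rle_trans; [apply Cmod_triangle|].
  apply Rplus_le_compat_r, IH.
Qed.

(* Functions of finite Dirichlet energy are Lipschitz from the hyperbolic
   metric; by AM-GM [2 |a_k| |z^k - w^k|] is at most
   [k |a_k|^2 / eta + eta k |z - w|^2 r^(2k-2)]. *)
Lemma energy_Lipschitz (nu eta r : R) (f : disk -> C) (a : nat -> C) (z w : disk) :
  1 / 2 <= nu -> 0 < eta -> r < 1 ->
  power_expansion f a -> energy_le nu a (eta ^ 2) ->
  Cmod z <= r -> Cmod w <= r -> Cmod (z - w) <= 1 - r ^ 2 ->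
  Cmod (f z - f w) <= eta.
Proof.
  intros Hnu Heta Hr Hf Ha Hz Hw Hzw. rewrite power_expansion_iff in Hf.
  pose proof (Cmod_ge_0 z) as Hz0. pose proof (Cmod_ge_0 (z - w)) as Hzw0.
  assert (Hs : @is_series C_AbsRing C_NormedModule
    (fun k => a k * z ^ k - a k * w ^ k)%C (f z - f w)%C).
  { replace (f z - f w)%C with (f z + -(1) * f w)%C by ring.
    eapply is_series_ext;
      [|apply (C_is_series_plus _ _ _ _ (Hf z) (C_is_series_scal _ _ _ (Hf w)))].
    intros k. simpl. ring. }
  apply (C_is_series_bound _ _ _ Hs). intros n.
  eapply Rle_trans; [apply Cmod_C_sum_le|].
  (* The constant term cancels in [f z - f w], hence the shift of the index. The total of [T] is at
     most [|z - w|^2 / (1 - r^2)^2], which the hypothesis on [|z - w|] bounds by 1. *)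
  set (T := fun k => match k with
    | O => 0
    | S m => Cmod (z - w) ^ 2 * (INR (m + 1) * (r ^ 2) ^ m)
    end).
  assert (HT : sum_n T n <= 1).
  { eapply Rle_trans; [apply (sum_n_incr T n (S n)); [|lia]|].
    - intros [|k]; simpl; [lra|]. apply Rmult_le_pos; [nra|].
      apply Rmult_le_pos; [apply pos_INR|apply pow_le; nra].
    - unfold T. rewrite sum_n_shift, sum_n_scal_R.
      eapply Rle_trans; [|apply (sum_n_arith_geom_le (r ^ 2) n); nra].
      rewrite Rmult_comm. apply Rmult_le_compat_l.
      + apply sum_n_nonneg. intros k.
        apply Rmult_le_pos; [apply pos_INR|apply pow_le; nra].
      + apply pow_incr. lra. }
  (* The weights in AM-GM are balanced so that the energy and [T] contribute [eta / 2] each. *)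
  apply Rle_trans with
    (sum_n (fun k => / (2 * eta) * energy nu a k + eta / 2 * T k) n).
  - apply sum_n_le_compat. intros k.
    replace (a k * z ^ k - a k * w ^ k)%C with (a k * (z ^ k - w ^ k))%C by ring.
    rewrite Cmod_mult. pose proof (Cmod_ge_0 (a k)) as Hak.
    assert (H2e : 0 < / (2 * eta)) by (apply Rinv_0_lt_compat; lra).
    destruct k as [|m].
    + simpl. replace (1 - 1)%C with (RtoC 0) by ring. rewrite Cmod_0.
      pose proof (energy_nonneg nu a 0). nra.
    + pose proof (Cmod_pow_minus_le z w r m Hz Hw) as Hp.
      pose proof (weight_ge_linear nu (S m) Hnu) as Hwt.
      replace (S m + 1)%nat with (S (m + 1)) in Hwt by lia. rewrite S_INR in Hwt.
      unfold T, energy. rewrite <- pow_mult, Nat.mul_comm, pow_mult.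
      set (N := INR (m + 1)) in *. set (A := Cmod (a (S m))) in *.
      set (D := Cmod (z - w)) in *. set (P := r ^ m) in *.
      assert (HN : 0 <= N) by apply pos_INR.
      apply Rle_trans with (A * (N * D * P)).
      { now apply Rmult_le_compat_l. }
      apply Rle_trans with (/ (2 * eta) * (A ^ 2 * N) + eta / 2 * (D ^ 2 * (N * P ^ 2))).
      { assert (E : / (2 * eta) * (A ^ 2 * N) + eta / 2 * (D ^ 2 * (N * P ^ 2))
          - A * (N * D * P) = / (2 * eta) * N * (A - eta * D * P) ^ 2)
          by (field; lra).
        assert (0 <= / (2 * eta) * N * (A - eta * D * P) ^ 2); [|lra].
        apply Rmult_le_pos; [apply Rmult_le_pos; lra|apply pow2_ge_0]. }
      apply Rplus_le_compat_r, Rmult_le_compat_l; [lra|].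
      apply Rmult_le_compat_l; [apply pow2_ge_0|lra].
  - rewrite sum_n_plus_R, !sum_n_scal_R.
    apply Rle_trans with (/ (2 * eta) * eta ^ 2 + eta / 2 * 1).
    + apply Rplus_le_compat; apply Rmult_le_compat_l; try lra; [|apply Ha].
      apply Rlt_le, Rinv_0_lt_compat. lra.
    + apply Req_le. field. lra.
Qed.

Lemma energy_Lipschitz_max (nu eta : R) (f : disk -> C) (a : nat -> C) (z w : disk) :
  1 / 2 <= nu -> 0 < eta -> power_expansion f a -> energy_le nu a (eta ^ 2) ->
  Cmod (z - w) <= 1 - Cmod z ^ 2 -> Cmod (z - w) <= 1 - Cmod w ^ 2 ->
  Cmod (f z - f w) <= eta.
Proof.
  intros Hnu Heta Hf Ha Hz Hw.
  apply (energy_Lipschitz nu eta (Rmax (Cmod z) (Cmod w)) f a);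
    auto using Rmax_l, Rmax_r.
  - apply Rmax_lub_lt; apply disk_lt_1.
  - apply Rmax_case; assumption.
Qed.

Definition id_coeff (k : nat) : C := if Nat.eqb k 1 then 1 else 0.

Lemma power_expansion_id : power_expansion (fun z => z) id_coeff.
Proof.
  apply power_expansion_iff. intros z.
  assert (H : forall n, C_sum (fun k => id_coeff k * z ^ k)%C (S n) = z).
  { induction n as [|n IH].
    - rewrite C_sum_S, C_sum_O. unfold id_coeff. simpl. ring.
    - rewrite C_sum_S, IH. unfold id_coeff. simpl. ring. }
  apply C_is_series_iff. intros eps He. exists 1%nat. intros [|n] Hn; [lia|].
  rewrite H. replace (z - z)%C with (RtoC 0) by ring. now rewrite Cmod_0.
Qed.

Lemma dirichlet_id (nu : R) : dirichlet nu (fun z => z).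
Proof.
  apply (energy_le_dirichlet nu _ id_coeff (weight nu 1)); [apply power_expansion_id|].
  assert (H : forall n, sum_n (energy nu id_coeff) (S n) = weight nu 1).
  { induction n as [|n IH].
    - rewrite sum_Sn_R, sum_O. unfold energy, id_coeff. simpl.
      rewrite Cmod_0, Cmod_1. ring.
    - rewrite sum_Sn_R, IH. unfold energy, id_coeff. simpl. rewrite Cmod_0. ring. }
  intros n. rewrite <- (H n). apply sum_n_incr; [apply energy_nonneg|lia].
Qed.

Lemma iter_composition (phi : disk -> disk) (f : disk -> C) (n : nat) :
  Nat.iter n (composition phi) f = fun z => f (Nat.iter n phi z).
Proof.
  induction n as [|n IH]; [reflexivity|].
  rewrite Nat.iter_succ, IH. unfold composition.
  apply functional_extensionality. intros z. now rewrite Nat.iter_succ_r.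
Qed.

(* Two orbits that stay at bounded hyperbolic distance give neighbourhoods of
   the identity function, whose translates stay away from it. *)
Lemma not_recurrent_of_orbits (phi : disk -> disk) (nu c : R) (p q : disk) :
  1 / 2 <= nu -> c < Cmod (p - q) ->
  (forall n, let z := Nat.iter n phi p in let w := Nat.iter n phi q in
     Cmod (z - w) <= 1 - Cmod z ^ 2 /\ Cmod (z - w) <= 1 - Cmod w ^ 2) ->
  (forall n, (0 < n)%nat -> Cmod (Nat.iter n phi p - Nat.iter n phi q)%C <= c) ->
  ~ recurrent nu (composition phi).
Proof.
  intros Hnu Hc Horb Hsep Hrec.
  (* Half of the gap: two deviations below [eps] cannot make up for the drop of the separation from
     [|p - q|] to [c]. *)
  set (eps := (Cmod (p - q) - c) / 2).
  set (dev := fun (f : disk -> C) n =>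
    ((f (Nat.iter n phi p) - Nat.iter n phi p)
     - (f (Nat.iter n phi q) - Nat.iter n phi q))%C).
  (* A single [delta] for all times leaves room for a ball around [f] whose radius does not depend
     on [n]. *)
  set (U := fun f => dirichlet nu f /\
    exists delta, delta < eps /\ forall n, Cmod (dev f n) <= delta).
  assert (Hopen : dirichlet_open nu U).
  { split; [now intros f [Hf _]|]. intros f [Hf [delta [Hd Hdev]]].
    exists ((eps - delta) / 2). split; [lra|]. intros g Hg Hgf.
    split; [exact Hg|]. exists (delta + (eps - delta) / 2). split; [lra|].
    pose proof (dirichlet_minus nu g f Hg Hf) as Hm.
    pose proof Hm as [[a Ha] _]. intros n.
    replace (dev g n) with (dev f n +
      ((g (Nat.iter n phi p) - f (Nat.iter n phi p))
       - (g (Nat.iter n phi q) - f (Nat.iter n phi q))))%C by (unfold dev; ring).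
    eapply Rle_trans; [apply Cmod_triangle|]. apply Rplus_le_compat; [apply Hdev|].
    destruct (Horb n) as [H1 H2].
    refine (energy_Lipschitz_max nu _ _ a _ _ Hnu _ Ha _ H1 H2); [lra|].
    apply energy_le_trans with (dirichlet_norm nu (fun z => g z - f z)%C ^ 2).
    - now apply dirichlet_energy_bound.
    - apply pow_incr. split; [apply dirichlet_norm_nonneg|lra]. }
  destruct (Hrec U Hopen) as [n [Hn [f [[_ [d1 [Hd1 Hf1]]] [_ [d2 [Hd2 Hf2]]]]]]].
  { exists (fun z => z). split; [apply dirichlet_id|]. exists 0.
    split; [unfold eps; lra|]. intros n. unfold dev.
    match goal with |- Cmod ?x <= 0 => replace x with (RtoC 0) by ring end.
    rewrite Cmod_0. lra. }
  (* The deviation of [f] at time [n] and that of its [n]-th iterate at time 0 involve the same two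
     values of [f], which cancel. *)
  specialize (Hf1 n). specialize (Hf2 O). specialize (Hsep n Hn).
  rewrite iter_composition in Hf2. unfold dev in Hf1, Hf2. simpl in Hf2.
  set (z := Nat.iter n phi p) in *. set (w := Nat.iter n phi q) in *.
  assert (Cmod (p - q) <= Cmod (z - w) + (d1 + d2)); [|unfold eps in *; lra].
  replace (p - q)%C with ((z - w) + ((f z - z - (f w - w))
    + - (f z - p - (f w - q))))%C by ring.
  eapply Rle_trans; [apply Cmod_triangle|]. apply Rplus_le_compat_l.
  eapply Rle_trans; [apply Cmod_triangle|]. rewrite Cmod_opp. lra.
Qed.

Lemma cayley_inv (alpha : C) (z : disk) : Cmod alpha = 1 ->
  cayley alpha z <> 0 /\ (Cconj alpha * z = 1 - / cayley alpha z)%C.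
Proof.
  intros Hal. pose proof (cayley_denominator alpha z Hal) as Hz.
  unfold cayley. split; [|field; exact Hz].
  intros H. apply C1_nz. rewrite <- (Cinv_r _ Hz), H. ring.
Qed.

(** Rotation by [Cconj alpha] preserves the modulus and takes [z] to [1 - 1 / v]. *)
Lemma Cmod2_of_cayley (alpha : C) (z : disk) (x y : R) : Cmod alpha = 1 ->
  cayley alpha z = (x, y) -> 1 - Cmod z ^ 2 = (2 * x - 1) / (x ^ 2 + y ^ 2).
Proof.
  intros Hal Hv. destruct (cayley_inv alpha z Hal) as [_ E].
  pose proof (Re_cayley alpha z Hal) as Hre. rewrite Hv in Hre, E. simpl in Hre.
  rewrite <- (Cmod_Cconj_unit_mult alpha z Hal), E, Cmod2_alt. simpl. field. nra.
Qed.

Lemma Cmod2_minus_of_cayley (alpha : C) (z w : disk) : Cmod alpha = 1 ->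
  Cmod (z - w) ^ 2 = Cmod (cayley alpha z - cayley alpha w) ^ 2 /
    (Cmod (cayley alpha z) ^ 2 * Cmod (cayley alpha w) ^ 2).
Proof.
  intros Hal. destruct (cayley_inv alpha z Hal) as [Hz Ez].
  destruct (cayley_inv alpha w Hal) as [Hw Ew].
  rewrite <- (Cmod_Cconj_unit_mult alpha (z - w) Hal).
  replace (Cconj alpha * (z - w))%C with (Cconj alpha * z - Cconj alpha * w)%C by ring.
  rewrite Ez, Ew.
  set (v := cayley alpha z) in *. set (u := cayley alpha w) in *.
  replace (1 - / v - (1 - / u))%C with ((v - u) / (v * u))%C by (field; now split).
  rewrite Cmod_div, Cmod_mult; [|now apply Cmult_neq_0].
  field. split; intros H; apply Cmod_eq_0 in H; contradiction.
Qed.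

Lemma C2_neq_0 : RtoC 2 <> 0.
Proof. intros H. apply RtoC_inj in H. lra. Qed.

Lemma parabolic_not_recurrent (phi : disk -> disk) (alpha : C) (t nu : R) :
  Cmod alpha = 1 -> t <> 0 ->
  (forall z : disk, (cayley alpha (phi z) = cayley alpha z - t * Ci)%C) ->
  1 / 2 <= nu -> ~ recurrent nu (composition phi).
Proof.
  intros Hal Ht Hphi Hnu.
  assert (Hp : Cmod (alpha / 2) < 1).
  { rewrite Cmod_div, Hal, Cmod_R, Rabs_pos_eq by (lra || exact C2_neq_0). lra. }
  (* These points have Cayley coordinates 2 and 1, so along the orbits the coordinates differ by 1
     throughout. *)
  set (p := mk_disk (alpha / 2) Hp). set (q := disk_zero).
  assert (Hvp : cayley alpha p = 2).
  { unfold cayley. simpl.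
    replace (1 - Cconj alpha * (alpha / 2))%C with (1 - (Cconj alpha * alpha) / 2)%C
      by (field; exact C2_neq_0).
    rewrite Cconj_unit by exact Hal. field. }
  assert (Hvq : cayley alpha q = 1).
  { unfold cayley. simpl. replace (1 - Cconj alpha * 0)%C with (RtoC 1) by ring.
    field. }
  assert (Hvz : forall n, cayley alpha (Nat.iter n phi p) = (2, - (INR n * t))).
  { intros n. rewrite (cayley_iter alpha _ phi Hphi), Hvp.
    apply injective_projections; simpl; ring. }
  assert (Hvw : forall n, cayley alpha (Nat.iter n phi q) = (1, - (INR n * t))).
  { intros n. rewrite (cayley_iter alpha _ phi Hphi), Hvq.
    apply injective_projections; simpl; ring. }
  assert (Hd : forall n, Cmod (Nat.iter n phi p - Nat.iter n phi q) ^ 2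
    = 1 / ((4 + (INR n * t) ^ 2) * (1 + (INR n * t) ^ 2))).
  { intros n. rewrite (Cmod2_minus_of_cayley alpha) by exact Hal.
    rewrite Hvz, Hvw, !Cmod2_alt. simpl. field. split; nra. }
  assert (Ht2 : 0 < t ^ 2) by (apply pow2_gt_0; exact Ht).
  (* With [s = (n t)^2] the squared distance is [1 / ((4 + s) (1 + s))]: it is 1/4 at [n = 0], and
     for [n >= 1] it is at most the value at which 4 replaces the first factor and [t^2] replaces
     [s] in the second. *)
  apply (not_recurrent_of_orbits phi nu (sqrt (1 / (4 * (1 + t ^ 2)))) p q Hnu).
  - specialize (Hd O). cbn [Nat.iter nat_rect] in Hd.
    apply Rsqr_incrst_0; [|apply sqrt_pos|apply Cmod_ge_0].
    rewrite Rsqr_sqrt, Rsqr_pow2.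
    + simpl Nat.iter in Hd. rewrite Hd. simpl INR.
      apply Rmult_lt_compat_l; [lra|]. apply Rinv_lt_contravar; nra.
    + apply Rlt_le, Rdiv_lt_0_compat; nra.
  - intros n z w. specialize (Hd n). fold z w in Hd.
    pose proof (Cmod2_of_cayley alpha z _ _ Hal (Hvz n)) as Hz.
    pose proof (Cmod2_of_cayley alpha w _ _ Hal (Hvw n)) as Hw.
    set (s := (INR n * t) ^ 2) in *.
    assert (Hs : 0 <= s) by apply pow2_ge_0.
    replace ((- (INR n * t)) ^ 2) with s in * by (unfold s; ring).
    (* Here [1 - |z|^2 = 3 / (4 + s)] and [1 - |w|^2 = 1 / (1 + s)]; the inequalities are compared
       after squaring. *)
    split; apply Rsqr_incr_0; rewrite ?Rsqr_pow2; try apply Cmod_ge_0.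
    + rewrite Hz, Hd. apply Rminus_le_0.
      match goal with |- 0 <= ?x => replace x with
        ((5 + 8 * s) / ((4 + s) ^ 2 * (1 + s))) by (field; lra) end.
      apply Rlt_le, Rdiv_lt_0_compat; [lra|].
      apply Rmult_lt_0_compat; [apply pow_lt|]; lra.
    + rewrite Hz. apply Rlt_le, Rdiv_lt_0_compat; lra.
    + rewrite Hw, Hd. apply Rminus_le_0.
      match goal with |- 0 <= ?x => replace x with
        (3 / ((1 + s) ^ 2 * (4 + s))) by (field; lra) end.
      apply Rlt_le, Rdiv_lt_0_compat; [lra|].
      apply Rmult_lt_0_compat; [apply pow_lt|]; lra.
    + rewrite Hw. apply Rlt_le, Rdiv_lt_0_compat; lra.
  - intros n Hn. specialize (Hd n).
    apply Rsqr_incr_0; [|apply Cmod_ge_0|apply sqrt_pos].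
    rewrite Rsqr_sqrt, Rsqr_pow2, Hd.
    + assert (H1 : 1 <= INR n) by (apply (le_INR 1 n); lia).
      assert (Hs : t ^ 2 <= (INR n * t) ^ 2).
      { rewrite Rpow_mult_distr. assert (1 <= INR n ^ 2) by (apply pow_R1_Rle; exact H1).
        nra. }
      apply Rmult_le_compat_l; [lra|]. apply Rinv_le_contravar; [nra|].
      apply Rmult_le_compat; lra.
    + apply Rlt_le, Rdiv_lt_0_compat; nra.
Qed.

(** * The case [nu < 1/2] *)

Lemma sum_n_geom_le (q : R) (n : nat) : 0 <= q -> sum_n (fun k => q ^ k) n * (1 - q) <= 1.
Proof.
  intros Hq. assert (E : sum_n (fun k => q ^ k) n * (1 - q) = 1 - q ^ S n).
  { induction n as [|n IH]; [rewrite sum_O; simpl; ring|].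
    rewrite sum_Sn_R, Rmult_plus_distr_r, IH. simpl. ring. }
  rewrite E. pose proof (pow_le q (S n) Hq). lra.
Qed.

(** * Kernels of the half-plane and their energy *)

Definition kernel (alpha s : C) (z : disk) : C := (/ (cayley alpha z + s))%C.

(** With [zeta = Cconj alpha * z] the kernel is [(1 - zeta) / (1 + s - s zeta)]. The coefficient of
    [zeta^(m+1)] joins two consecutive terms of the geometric series, which produces the square. *)
Definition kernel_coeff (alpha s : C) (k : nat) : C :=
  match k with
  | O => (/ (1 + s))%C
  | S m => (- (/ (1 + s)) ^ 2 * (s / (1 + s)) ^ m * Cconj alpha ^ S m)%C
  end.

Lemma Cmod2_1_plus (s : C) : Cmod (1 + s) ^ 2 = 1 + 2 * Re s + Cmod s ^ 2.
Proof. rewrite !Cmod2_alt. destruct s as [x y]. simpl. ring. Qed.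

Lemma Cmod_1_plus_ge (s : C) : 0 <= Re s -> 1 <= Cmod (1 + s) ^ 2.
Proof. intros H. rewrite Cmod2_1_plus. pose proof (pow2_ge_0 (Cmod s)). lra. Qed.

Lemma C_1_plus_neq_0 (s : C) : 0 <= Re s -> (1 + s)%C <> 0.
Proof.
  intros H E. apply Cmod_1_plus_ge in H. rewrite E, Cmod_0 in H. lra.
Qed.

Lemma Cmod_lt_1_plus (s : C) : 0 <= Re s -> Cmod s < Cmod (1 + s).
Proof.
  intros H. pose proof (Cmod2_1_plus s). pose proof (Cmod_ge_0 s).
  pose proof (Cmod_ge_0 (1 + s)). nra.
Qed.

Lemma power_expansion_kernel (alpha s : C) : Cmod alpha = 1 -> 0 <= Re s ->
  power_expansion (kernel alpha s) (kernel_coeff alpha s).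
Proof.
  intros Hal Hs. apply power_expansion_iff. intros z.
  pose proof (cayley_denominator alpha z Hal) as Hz.
  pose proof (C_1_plus_neq_0 s Hs) as HD.
  set (zeta := (Cconj alpha * z)%C) in *.
  assert (Hzeta : Cmod zeta < 1).
  { unfold zeta. rewrite Cmod_Cconj_unit_mult by exact Hal. apply disk_lt_1. }
  assert (HE : (1 + s - s * zeta)%C <> 0).
  { intros E. assert (E' : (1 + s = s * zeta)%C).
    { replace (1 + s)%C with (1 + s - s * zeta + s * zeta)%C by ring. rewrite E. ring. }
    pose proof (Cmod_lt_1_plus s Hs) as Hlt. rewrite E', Cmod_mult in Hlt.
    pose proof (Cmod_ge_0 s). nra. }
  assert (HK : kernel alpha s z = ((1 - zeta) / (1 + s - s * zeta))%C).
  { unfold kernel, cayley. fold zeta. field.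
    now split. }
  set (R0 := (/ (1 + s) / (1 + s - s * zeta))%C).
  (* The exact remainder of the geometric series; since [|s / (1 + s)| < 1], it decays at least like
     [|zeta|^n]. *)
  assert (Hsum : forall n, (C_sum (fun k => kernel_coeff alpha s k * z ^ k)%C n
      - kernel alpha s z = R0 * (s / (1 + s)) ^ n * zeta ^ S n)%C).
  { intros n. rewrite HK. induction n as [|n IH].
    - rewrite C_sum_O. unfold R0. simpl. field. now split.
    - rewrite C_sum_S.
      match goal with |- (?x + ?y - ?w)%C = _ =>
        replace (x + y - w)%C with ((x - w) + y)%C by ring end.
      rewrite IH. unfold kernel_coeff.
      replace (- (/ (1 + s)) ^ 2 * (s / (1 + s)) ^ n * Cconj alpha ^ S n * z ^ S n)%C
        with (- (/ (1 + s)) ^ 2 * (s / (1 + s)) ^ n * zeta ^ S n)%C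
        by (unfold zeta; rewrite Cpow_mult_l; ring).
      unfold R0. rewrite (Cpow_S _ (S n)), (Cpow_S (s / (1 + s)) n).
      field. now split. }
  apply (C_is_series_geom_remainder _ _ (Cmod R0) (Cmod zeta)).
  { split; [apply Cmod_ge_0|exact Hzeta]. }
  intros n. rewrite Hsum, !Cmod_mult, !Cmod_pow.
  assert (Hu : Cmod (s / (1 + s)) ^ n <= 1).
  { rewrite Cmod_div by exact HD. apply Rle_trans with (1 ^ n); [apply pow_incr|rewrite pow1; lra].
    pose proof (Cmod_lt_1_plus s Hs). pose proof (Cmod_ge_0 s).
    split; [apply Rdiv_le_0_compat; lra|].
    apply Rmult_le_reg_r with (Cmod (1 + s)); [lra|].
    unfold Rdiv. rewrite Rmult_assoc, Rinv_l; lra. }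
  pose proof (Cmod_ge_0 R0). pose proof (Cmod_ge_0 zeta).
  pose proof (pow_le _ n (Cmod_ge_0 zeta)).
  pose proof (pow_le _ n (Cmod_ge_0 (s / (1 + s)))).
  rewrite <- tech_pow_Rmult.
  assert (0 <= Cmod zeta * Cmod zeta ^ n <= Cmod zeta ^ n) by nra.
  rewrite Rmult_assoc. apply Rmult_le_compat_l; [assumption|]. nra.
Qed.

(* The part of the energy of Dirichlet type does not exceed [3 eps], whatever
   [s] is, because the Dirichlet integral is invariant under translations. *)
Lemma kernel_energy (nu eps K : R) (alpha s : C) :
  Cmod alpha = 1 -> 0 <= Re s -> 0 < eps -> 0 < K ->
  (forall k, weight nu k <= eps * INR (k + 1) + K) ->
  energy_le nu (kernel_coeff alpha s) (3 * eps + 2 * (K / Cmod (1 + s) ^ 2)).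
Proof.
  intros Hal Hs Heps HK Hw.
  pose proof (Cmod_1_plus_ge s Hs) as HM. pose proof (C_1_plus_neq_0 s Hs) as HD.
  pose proof (Cmod2_1_plus s) as HMs. pose proof (pow2_ge_0 (Cmod s)) as Hs2.
  set (q := Cmod (s / (1 + s)) ^ 2).
  assert (Hq : q = Cmod s ^ 2 / Cmod (1 + s) ^ 2).
  { unfold q. rewrite Cmod_div by exact HD. field.
    intros E. rewrite E in HM. lra. }
  set (M := Cmod (1 + s) ^ 2) in *.
  assert (Hq0 : 0 <= q) by apply pow2_ge_0.
  assert (HiM : 0 < / M) by (apply Rinv_0_lt_compat; lra).
  assert (HMM : M * / M = 1) by (apply Rinv_r; lra).
  (* Indeed [1 - q = (1 + 2 Re s) / M]. Hence the sum of [(k + 1) q^k] is at most [M^2] and that of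
     [q^k] at most [M], against a factor [M^(-2)] in the energy. *)
  assert (Hq1 : / M <= 1 - q) by (rewrite Hq; unfold Rdiv; nra).
  (* The factor 2 absorbs the index shift, as [m + 2 <= 2 (m + 1)]. The constant coefficient adds
     the third [eps] and the second [K / M]. *)
  set (B := fun m => (/ M) ^ 2 * (2 * eps) * (INR (m + 1) * q ^ m) + (/ M) ^ 2 * K * q ^ m).
  assert (Hterm : forall m, energy nu (kernel_coeff alpha s) (S m) <= B m).
  { intros m. unfold energy, kernel_coeff, B.
    rewrite !Cmod_mult, Cmod_opp, !Cmod_pow, Cmod_conj, Hal, pow1, Cmod_inv by exact HD.
    replace (((/ Cmod (1 + s)) ^ 2 * Cmod (s / (1 + s)) ^ m * 1) ^ 2)
      with ((/ M) ^ 2 * q ^ m).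
    2:{ unfold M, q. rewrite <- !pow_mult, (Nat.mul_comm 2 m), pow_mult.
        rewrite <- pow_inv. ring. }
    specialize (Hw (S m)). replace (S m + 1)%nat with (S (m + 1)) in Hw by lia.
    rewrite S_INR in Hw.
    assert (HN : 1 <= INR (m + 1)).
    { rewrite plus_INR. pose proof (pos_INR m). simpl. lra. }
    assert (Hw' : weight nu (S m) <= 2 * eps * INR (m + 1) + K) by nra.
    assert (H0 : 0 <= (/ M) ^ 2 * q ^ m).
    { apply Rmult_le_pos; [apply pow2_ge_0|now apply pow_le]. }
    apply (Rmult_le_compat_l _ _ _ H0) in Hw'. lra. }
  assert (HB : forall n, sum_n B n <= 2 * eps + K * / M).
  { intros n. unfold B. rewrite sum_n_plus_R, !sum_n_scal_R.
    assert (H1 : / M * / M * sum_n (fun k => INR (k + 1) * q ^ k) n <= 1).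
    { eapply Rle_trans; [|apply (sum_n_arith_geom_le q n); lra].
      rewrite Rmult_comm. apply Rmult_le_compat_l; [|nra].
      apply sum_n_nonneg. intros k.
      apply Rmult_le_pos; [apply pos_INR|now apply pow_le]. }
    assert (H2 : / M * sum_n (fun k => q ^ k) n <= 1).
    { eapply Rle_trans; [|apply (sum_n_geom_le q n Hq0)].
      rewrite Rmult_comm. apply Rmult_le_compat_l; [|exact Hq1].
      apply sum_n_nonneg. intros k. now apply pow_le. }
    set (S1 := sum_n (fun k => INR (k + 1) * q ^ k) n) in *.
    set (S2 := sum_n (fun k => q ^ k) n) in *.
    apply Rplus_le_compat.
    - replace ((/ M) ^ 2 * (2 * eps) * S1) with (2 * eps * (/ M * / M * S1)) by ring.
      nra.
    - replace ((/ M) ^ 2 * K * S2) with (K * / M * (/ M * S2)) by ring.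
      assert (0 < K * / M) by nra. nra. }
  assert (H0 : energy nu (kernel_coeff alpha s) 0 <= eps + K * / M).
  { unfold energy, kernel_coeff. rewrite Cmod_inv by exact HD.
    rewrite pow_inv. fold M. specialize (Hw 0%nat). simpl in Hw.
    rewrite Rmult_1_r in Hw. apply (Rmult_le_compat_l (/ M)) in Hw; [|lra].
    assert (/ M * eps <= eps) by nra. lra. }
  intros n. apply Rle_trans with
    (sum_n (energy nu (kernel_coeff alpha s)) (S n)).
  { apply sum_n_incr; [apply energy_nonneg|lia]. }
  apply Rle_trans with (energy nu (kernel_coeff alpha s) 0 + sum_n B n).
  - induction n as [|n IH].
    + rewrite sum_Sn_R, !sum_O. apply Rplus_le_compat_l, Hterm.
    + rewrite sum_Sn_R, (sum_Sn_R B). specialize (Hterm (S n)). lra.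
  - specialize (HB n). unfold Rdiv. lra.
Qed.

(** Convergence of the iterates to 0 in norm; the expansion is part of the claim, so membership of
    the composites in the space comes with the bound. *)
Definition vanishing (nu : R) (phi : disk -> disk) (f : disk -> C) : Prop :=
  forall eps, 0 < eps -> exists N, forall n, (N <= n)%nat ->
    exists a, power_expansion (fun z => f (Nat.iter n phi z)) a /\ energy_le nu a eps.

Lemma vanishing_plus (nu : R) (phi : disk -> disk) (f g : disk -> C) :
  vanishing nu phi f -> vanishing nu phi g -> vanishing nu phi (fun z => f z + g z)%C.
Proof.
  intros Hf Hg eps He.
  destruct (Hf (eps / 4)) as [N HN]; [lra|].
  destruct (Hg (eps / 4)) as [N' HN']; [lra|].
  exists (Nat.max N N'). intros n Hn.
  destruct (HN n) as [a [Ha Ea]]; [lia|]. destruct (HN' n) as [b [Hb Eb]]; [lia|].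
  exists (fun k => a k + b k)%C. split.
  - exact (power_expansion_plus _ _ _ _ Ha Hb).
  - replace eps with (2 * (eps / 4) + 2 * (eps / 4)) by field.
    now apply energy_le_plus.
Qed.

Lemma vanishing_scal (nu : R) (phi : disk -> disk) (x : C) (f : disk -> C) :
  vanishing nu phi f -> vanishing nu phi (fun z => x * f z)%C.
Proof.
  intros Hf eps He. pose proof (pow2_ge_0 (Cmod x)) as Hx.
  destruct (Hf (eps / (1 + Cmod x ^ 2))) as [N HN]; [apply Rdiv_lt_0_compat; lra|].
  exists N. intros n Hn. destruct (HN n Hn) as [a [Ha Ea]].
  exists (fun k => x * a k)%C. split.
  - exact (power_expansion_scal x _ _ Ha).
  - eapply energy_le_trans; [apply energy_le_scal, Ea|].
    apply Rmult_le_reg_r with (1 + Cmod x ^ 2); [lra|].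
    replace (Cmod x ^ 2 * (eps / (1 + Cmod x ^ 2)) * (1 + Cmod x ^ 2))
      with (Cmod x ^ 2 * eps) by (field; lra). nra.
Qed.

Lemma vanishing_kernel (nu t s : R) (alpha : C) (phi : disk -> disk) :
  nu < 1 / 2 -> Cmod alpha = 1 -> t <> 0 -> 0 <= s ->
  (forall z : disk, (cayley alpha (phi z) = cayley alpha z - t * Ci)%C) ->
  vanishing nu phi (kernel alpha s).
Proof.
  intros Hnu Hal Ht Hs Hphi eps He.
  (* The Dirichlet part of the energy is then at most [eps / 2], and the Hardy part [2 K / M] is too
     once [M >= 4 K / eps]. *)
  destruct (weight_sublinear nu Hnu (eps / 6)) as [K [HK Hw]]; [lra|].
  assert (Ht2 : 0 < t ^ 2) by (apply pow2_gt_0; exact Ht).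
  destruct (archimed_nat (t ^ 2) (4 * K / eps) Ht2) as [N HN].
  exists N. intros n Hn. set (s' := (s - INR n * (t * Ci))%C).
  assert (Hre : Re s' = s) by (unfold s'; simpl; ring).
  exists (kernel_coeff alpha s'). split.
  - replace (fun z => kernel alpha s (Nat.iter n phi z)) with (kernel alpha s').
    + apply power_expansion_kernel; [exact Hal|lra].
    + apply functional_extensionality. intros z. unfold kernel.
      rewrite (cayley_iter alpha _ phi Hphi). unfold s'. f_equal. ring.
  - eapply energy_le_trans.
    + apply (kernel_energy nu (eps / 6) K); try assumption; lra.
    + assert (HM : INR N * t ^ 2 <= Cmod (1 + s') ^ 2).
      { rewrite Cmod2_alt. unfold s'. simpl.
        apply le_INR in Hn. pose proof (pos_INR N).
        assert (0 <= (INR n - INR N) * t ^ 2) by (apply Rmult_le_pos; lra).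
        assert (0 <= (INR n * t) ^ 2) by apply pow2_ge_0.
        destruct n as [|n]; [simpl in *; nra|].
        assert (1 <= INR (S n)) by (rewrite S_INR; pose proof (pos_INR n); lra).
        set (x := INR (S n)) in *.
        assert (x * t ^ 2 <= (x * t) ^ 2) by (rewrite Rpow_mult_distr; nra).
        assert (0 <= (1 + s) ^ 2) by apply pow2_ge_0.
        nra. }
      set (M := Cmod (1 + s') ^ 2) in *.
      assert (HM0 : 0 < M).
      { assert (0 < 4 * K / eps) by (apply Rdiv_lt_0_compat; lra). lra. }
      assert (K / M <= eps / 4); [|lra].
      apply Rmult_le_reg_r with (M * (4 / eps)).
      { apply Rmult_lt_0_compat; [lra|apply Rdiv_lt_0_compat; lra]. }
      replace (K / M * (M * (4 / eps))) with (4 * K / eps) by (field; lra).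
      replace (eps / 4 * (M * (4 / eps))) with M by (field; lra). lra.
Qed.

(** Closure of the functions that vanish along both maps. It is stated for coefficient sequences, so
    that truncations can be handled without naming the function they represent. *)
Definition approximable (nu : R) (phi psi : disk -> disk) (a : nat -> C) : Prop :=
  forall eps, 0 < eps -> exists f b,
    vanishing nu phi f /\ vanishing nu psi f /\ power_expansion f b /\
    energy_le nu (fun k => a k - b k)%C eps.

Lemma approximable_ext (nu : R) (phi psi : disk -> disk) (a b : nat -> C) :
  (forall k, a k = b k) -> approximable nu phi psi a -> approximable nu phi psi b.
Proof.
  intros H Ha. now replace b with a by now apply functional_extensionality.
Qed.

Lemma approximable_plus (nu : R) (phi psi : disk -> disk) (a b : nat -> C) :
  approximable nu phi psi a -> approximable nu phi psi b ->
  approximable nu phi psi (fun k => a k + b k)%C.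
Proof.
  intros Ha Hb eps He.
  destruct (Ha (eps / 4)) as [f [a' [Hf1 [Hf2 [Hf3 Hf4]]]]]; [lra|].
  destruct (Hb (eps / 4)) as [g [b' [Hg1 [Hg2 [Hg3 Hg4]]]]]; [lra|].
  exists (fun z => f z + g z)%C, (fun k => a' k + b' k)%C.
  repeat split; try now apply vanishing_plus.
  - now apply power_expansion_plus.
  - replace eps with (2 * (eps / 4) + 2 * (eps / 4)) by field.
    eapply energy_le_ext; [|exact (energy_le_plus _ _ _ _ _ Hf4 Hg4)].
    intros k. simpl. ring.
Qed.

Lemma approximable_scal (nu : R) (phi psi : disk -> disk) (x : C) (a : nat -> C) :
  approximable nu phi psi a -> approximable nu phi psi (fun k => x * a k)%C.
Proof.
  intros Ha eps He. pose proof (pow2_ge_0 (Cmod x)) as Hx.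
  destruct (Ha (eps / (1 + Cmod x ^ 2))) as [f [a' [Hf1 [Hf2 [Hf3 Hf4]]]]];
    [apply Rdiv_lt_0_compat; lra|].
  exists (fun z => x * f z)%C, (fun k => x * a' k)%C.
  repeat split; try now apply vanishing_scal.
  - now apply power_expansion_scal.
  - apply energy_le_trans with (Cmod x ^ 2 * (eps / (1 + Cmod x ^ 2))).
    + eapply energy_le_ext; [|exact (energy_le_scal _ x _ _ Hf4)].
      intros k. simpl. ring.
    + apply Rmult_le_reg_r with (1 + Cmod x ^ 2); [lra|].
      replace (Cmod x ^ 2 * (eps / (1 + Cmod x ^ 2)) * (1 + Cmod x ^ 2))
        with (Cmod x ^ 2 * eps) by (field; lra). nra.
Qed.

Lemma approximable_minus (nu : R) (phi psi : disk -> disk) (a b : nat -> C) :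
  approximable nu phi psi a -> approximable nu phi psi b ->
  approximable nu phi psi (fun k => a k - b k)%C.
Proof.
  intros Ha Hb. apply (approximable_ext _ _ _ (fun k => a k + -(1) * b k)%C).
  - intros k. ring.
  - apply approximable_plus; [exact Ha|now apply approximable_scal].
Qed.

Lemma approximable_closed (nu : R) (phi psi : disk -> disk) (a : nat -> C) :
  (forall eps, 0 < eps -> exists b, approximable nu phi psi b /\
     energy_le nu (fun k => a k - b k)%C eps) ->
  approximable nu phi psi a.
Proof.
  intros H eps He. destruct (H (eps / 4)) as [b [Hb Hab]]; [lra|].
  destruct (Hb (eps / 4)) as [f [c [Hf1 [Hf2 [Hf3 Hf4]]]]]; [lra|].
  exists f, c. repeat split; try assumption.
  replace eps with (2 * (eps / 4) + 2 * (eps / 4)) by field.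
  eapply energy_le_ext; [|exact (energy_le_plus _ _ _ _ _ Hab Hf4)].
  intros k. simpl. ring.
Qed.

Lemma approximable_of_vanishing (nu : R) (phi psi : disk -> disk)
    (f : disk -> C) (a : nat -> C) :
  power_expansion f a -> vanishing nu phi f -> vanishing nu psi f ->
  approximable nu phi psi a.
Proof.
  intros Hf H1 H2 eps He. exists f, a. repeat split; try assumption.
  intros n. apply Rle_trans with (sum_n (fun _ => 0) n).
  - apply sum_n_le_compat. intros k. unfold energy.
    replace (a k - a k)%C with (RtoC 0) by ring. rewrite Cmod_0. simpl. lra.
  - rewrite sum_n_const. lra.
Qed.

(** * Density of the functions that vanish along both maps *)

Lemma energy_le_geometric (nu : R) : nu < 1 / 2 ->
  exists E, 0 < E /\ forall (a : nat -> C) (A : R),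
    (forall k, Cmod (a k) <= A * (/ 2) ^ k) -> energy_le nu a (A ^ 2 * E).
Proof.
  intros Hnu. destruct (weight_sublinear nu Hnu 1 Rlt_0_1) as [K [HK Hw]].
  (* The weight is at most [(1 + K) (k + 1)], and 16/9 is the sum of [(k + 1) / 4^k]. *)
  exists ((1 + K) * (16 / 9)). split; [lra|]. intros a A Ha n.
  apply Rle_trans with
    (sum_n (fun k => A ^ 2 * (1 + K) * (INR (k + 1) * (/ 4) ^ k)) n).
  - apply sum_n_le_compat. intros k. unfold energy.
    assert (Hk : 1 <= INR (k + 1)).
    { rewrite plus_INR. pose proof (pos_INR k). simpl. lra. }
    assert (H1 : Cmod (a k) ^ 2 <= A ^ 2 * (/ 4) ^ k).
    { replace (A ^ 2 * (/ 4) ^ k) with ((A * (/ 2) ^ k) ^ 2).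
      - apply pow_incr. split; [apply Cmod_ge_0|apply Ha].
      - replace (/ 4) with ((/ 2) ^ 2) by field.
        rewrite <- pow_mult, (Nat.mul_comm 2 k), pow_mult. ring. }
    assert (H2 : weight nu k <= (1 + K) * INR (k + 1)).
    { specialize (Hw k). nra. }
    replace (A ^ 2 * (1 + K) * (INR (k + 1) * (/ 4) ^ k))
      with (A ^ 2 * (/ 4) ^ k * ((1 + K) * INR (k + 1))) by ring.
    apply Rmult_le_compat; [apply pow2_ge_0|apply Rlt_le, weight_pos|exact H1|exact H2].
  - rewrite sum_n_scal_R, Rmult_assoc.
    apply Rmult_le_compat_l; [apply pow2_ge_0|].
    apply Rmult_le_compat_l; [lra|].
    pose proof (sum_n_arith_geom_le (/ 4) n). lra.
Qed.

(* Taylor coefficients of [(beta z)^J (1 - beta z) / (1 - u beta z)]; as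
   [0 ^ 0 = 1], they are those of [(beta z)^J - (beta z)^(J+1)] at [u = 0]. *)
Definition shifted_kernel (beta u : C) (J k : nat) : C :=
  if Nat.ltb k J then 0 else
  if Nat.eqb k J then beta ^ J else (u - 1) * u ^ (k - J - 1) * beta ^ k.

(** With [x = beta z] this is [1 / (1 - u x) = 1 + u x / (1 - u x)], multiplied by [x^J (1 - x)]. *)
Lemma shifted_kernel_step (beta u : C) (J k : nat) :
  shifted_kernel beta u J k =
  (shifted_kernel beta 0 J k + u * shifted_kernel beta u (S J) k)%C.
Proof.
  unfold shifted_kernel.
  destruct (Nat.ltb_spec k J); destruct (Nat.eqb_spec k J);
    destruct (Nat.ltb_spec k (S J)); destruct (Nat.eqb_spec k (S J));
    try lia; try ring.
  - subst k. replace (S J - J - 1)%nat with O by lia. simpl. ring.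
  - replace (k - J - 1)%nat with (S (k - S J - 1)) by lia. simpl. ring.
Qed.

(** Uniformity in [u] keeps the energy bounded while [u] tends to 0. *)
Lemma shifted_kernel_bound (beta : C) (u : R) (J k : nat) :
  Cmod beta = 1 -> 0 <= u <= 1 / 2 ->
  Cmod (shifted_kernel beta u J k) <= 2 ^ (J + 1) * (/ 2) ^ k.
Proof.
  intros Hb Hu. unfold shifted_kernel.
  assert (H2 : forall i j : nat, 0 <= 2 ^ i * (/ 2) ^ j).
  { intros i j. apply Rmult_le_pos; apply pow_le; lra. }
  assert (Hinv : forall i, 2 ^ i * (/ 2) ^ i = 1).
  { intros i. rewrite <- Rpow_mult_distr, Rinv_r by lra. apply pow1. }
  destruct (Nat.ltb_spec k J); [rewrite Cmod_0; apply H2|].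
  destruct (Nat.eqb_spec k J).
  - subst k. rewrite Cmod_pow, Hb, pow1, pow_add. specialize (Hinv J). simpl. lra.
  - rewrite !Cmod_mult, !Cmod_pow, Hb, pow1, <- RtoC_minus, !Cmod_R.
    rewrite (Rabs_left1 (u - 1)), (Rabs_pos_eq u) by lra.
    replace (2 ^ (J + 1) * (/ 2) ^ k) with ((/ 2) ^ (k - J - 1)).
    + assert (u ^ (k - J - 1) <= (/ 2) ^ (k - J - 1)) by (apply pow_incr; lra).
      assert (0 <= u ^ (k - J - 1)) by (apply pow_le; lra). nra.
    + replace ((/ 2) ^ k) with ((/ 2) ^ (J + 1) * (/ 2) ^ (k - J - 1)).
      * rewrite <- Rmult_assoc, Hinv. ring.
      * rewrite <- pow_add. f_equal. lia.
Qed.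

(** The value [s = u / (1 - u)] solves [u = s / (1 + s)], the ratio of the geometric series of the
    kernel. *)
Lemma shifted_kernel_O (alpha : C) (u : R) (k : nat) : 0 < u <= 1 / 2 ->
  shifted_kernel (Cconj alpha) u 0 k =
  ((1 + (u / (1 - u))%R) * kernel_coeff alpha (u / (1 - u))%R k)%C.
Proof.
  intros Hu.
  assert (Hne : (1 - u)%C <> 0).
  { rewrite <- RtoC_minus. intros H. apply RtoC_inj in H. lra. }
  rewrite RtoC_div, RtoC_minus by lra.
  assert (E : (1 + u / (1 - u) = / (1 - u))%C) by (field; exact Hne).
  assert (E' : (u / (1 - u) / (1 + u / (1 - u)) = u)%C).
  { rewrite E. field. exact Hne. }
  unfold shifted_kernel, kernel_coeff. destruct k as [|m].
  - rewrite E. cbn [Nat.ltb Nat.leb Nat.eqb Cpow]. field. exact Hne.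
  - rewrite E', E. cbn [Nat.ltb Nat.leb Nat.eqb].
    replace (S m - 0 - 1)%nat with m by lia. field. exact Hne.
Qed.

Definition coordinate (beta : C) (j k : nat) : C :=
  if Nat.eqb k j then beta ^ j else 0.

Lemma shifted_kernel_zero (beta : C) (J k : nat) :
  shifted_kernel beta 0 J k = (coordinate beta J k - coordinate beta (S J) k)%C.
Proof.
  unfold shifted_kernel, coordinate.
  destruct (Nat.ltb_spec k J); destruct (Nat.eqb_spec k J);
    destruct (Nat.eqb_spec k (S J)); try lia; try ring.
  - subst k. replace (S J - J - 1)%nat with O by lia. simpl. ring.
  - replace (k - J - 1)%nat with (S (k - J - 2)) by lia. simpl. ring.
Qed.

Lemma sum_n_support_le (u : nat -> R) (N n : nat) :
  (forall k, 0 <= u k) -> (forall k, (N < k)%nat -> u k = 0) ->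
  sum_n u n <= sum_n u N.
Proof.
  intros Hu Hs. destruct (Nat.le_gt_cases n N) as [H|H].
  - now apply sum_n_incr.
  - induction H as [|m Hm IH].
    + rewrite sum_Sn_R, Hs by lia. lra.
    + rewrite sum_Sn_R, (Hs (S m)) by lia. lra.
Qed.

Lemma sum_n_INR_le (n : nat) : sum_n (fun k => INR (k + 1)) n <= (INR n + 1) ^ 2.
Proof.
  induction n as [|n IH]; [rewrite sum_O; simpl; lra|].
  rewrite sum_Sn_R, plus_INR, S_INR. pose proof (pos_INR n). simpl INR. nra.
Qed.

(** Write [x = beta z]. Letting [u] tend to 0 in the kernels yields, for each [J] in turn,
    [x^J - x^(J+1)] and then the next shifted kernels. The differences telescope to [1 - x^j], their
    averages tend to 1, and so all monomials, all polynomials and all of the space are reached. *)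
Lemma approximable_all (nu t : R) (alpha : C) (phi psi : disk -> disk) (a : nat -> C) :
  nu < 1 / 2 -> Cmod alpha = 1 -> t <> 0 ->
  (forall z : disk, (cayley alpha (phi z) = cayley alpha z - t * Ci)%C) ->
  (forall z : disk, (cayley alpha (psi z) = cayley alpha z - (- t)%R * Ci)%C) ->
  ex_series (energy nu a) -> approximable nu phi psi a.
Proof.
  intros Hnu Hal Ht Hphi Hpsi Hex.
  set (beta := Cconj alpha).
  assert (Hbeta : Cmod beta = 1) by (unfold beta; now rewrite Cmod_conj).
  destruct (energy_le_geometric nu Hnu) as [E [HE Hgeom]].
  assert (Hker : forall J (u : R), 0 < u <= 1 / 2 ->
    approximable nu phi psi (shifted_kernel beta u J)).
  { induction J as [|J IH]; intros u Hu.
    - apply (approximable_ext _ _ _ _ _ (fun k => eq_sym (shifted_kernel_O alpha u k Hu))).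
      apply approximable_scal.
      assert (Hs : 0 <= u / (1 - u)) by (apply Rdiv_le_0_compat; lra).
      apply approximable_of_vanishing with (kernel alpha (u / (1 - u))%R).
      + now apply power_expansion_kernel.
      + now apply (vanishing_kernel nu t).
      + apply (vanishing_kernel nu (- t)); try assumption. lra.
    - assert (H0 : approximable nu phi psi (shifted_kernel beta 0 J)).
      { apply approximable_closed. intros eps He.
        set (A := 2 ^ (S J + 1)). assert (HA : 0 < A) by (apply pow_lt; lra).
        assert (HAE : 0 < A ^ 2 * E) by (apply Rmult_lt_0_compat; [apply pow_lt|]; lra).
        (* The distance from parameter 0 to parameter [v] has energy at most [v^2 A^2 E], and
           [v^2 <= v]. *)
        set (v := Rmin (1 / 2) (eps / (A ^ 2 * E))).
        assert (Hv : 0 < v) by (apply Rmin_glb_lt; [lra|now apply Rdiv_lt_0_compat]).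
        assert (Hv1 : v <= 1 / 2) by apply Rmin_l.
        assert (Hv2 : v * (A ^ 2 * E) <= eps).
        { apply Rle_trans with (eps / (A ^ 2 * E) * (A ^ 2 * E)).
          - apply Rmult_le_compat_r; [lra|apply Rmin_r].
          - apply Req_le. field. split; lra. }
        exists (shifted_kernel beta v J). split; [apply IH; lra|].
        apply (energy_le_ext _ (fun k => - v * shifted_kernel beta v (S J) k)%C).
        { intros k. rewrite (shifted_kernel_step beta v J k). ring. }
        eapply energy_le_trans.
        - apply energy_le_scal, Hgeom. intros k.
          apply shifted_kernel_bound; [exact Hbeta|lra].
        - fold A. rewrite Cmod_opp, Cmod_R, Rabs_pos_eq by lra.
          assert (v ^ 2 <= v) by nra. nra. }
      (* The step identity solved for the kernel with shift [S J]. *)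
      apply (approximable_ext _ _ _ (fun k =>
        / u * (shifted_kernel beta u J k - shifted_kernel beta 0 J k))%C).
      { intros k. rewrite (shifted_kernel_step beta u J k). field.
        intros Hc. apply RtoC_inj in Hc. lra. }
      apply approximable_scal, approximable_minus; [now apply IH|exact H0]. }
  assert (Hdiff : forall j, approximable nu phi psi
    (fun k => coordinate beta 0 k - coordinate beta j k)%C).
  { assert (Hstep : forall J, approximable nu phi psi (shifted_kernel beta 0 J)).
    { intros J. apply (approximable_ext _ _ _ (fun k =>
        shifted_kernel beta (1 / 2)%R J k
          - (1 / 2)%R * shifted_kernel beta (1 / 2)%R (S J) k)%C).
      - intros k. rewrite (shifted_kernel_step beta (1 / 2)%R J k). ring.
      - apply approximable_minus; [|apply approximable_scal]; apply Hker; lra. }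
    induction j as [|j IH].
    - apply (approximable_ext _ _ _ (fun k => 0 * shifted_kernel beta 0 0 k)%C).
      + intros k. ring.
      + apply approximable_scal, Hstep.
    - apply (approximable_ext _ _ _ (fun k =>
        (coordinate beta 0 k - coordinate beta j k) + shifted_kernel beta 0 j k)%C).
      + intros k. rewrite shifted_kernel_zero. ring.
      + now apply approximable_plus. }
  (* The coefficients of the sum of [1 - x^j] over [1 <= j <= N]. *)
  set (V := fun N k : nat => if Nat.eqb k 0 then RtoC (INR N) else
    if Nat.leb k N then (- beta ^ k)%C else RtoC 0).
  assert (HV : forall N, approximable nu phi psi (V N)).
  { induction N as [|N IH].
    - apply (approximable_ext _ _ _ (fun k => coordinate beta 0 k - coordinate beta 0 k)%C).
      + intros [|k]; unfold V; simpl; ring.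
      + apply Hdiff.
    - apply (approximable_ext _ _ _ (fun k =>
        V N k + (coordinate beta 0 k - coordinate beta (S N) k))%C).
      + intros k. unfold V, coordinate. rewrite S_INR, RtoC_plus.
        destruct (Nat.eqb_spec k 0); destruct (Nat.leb_spec k N);
          destruct (Nat.leb_spec k (S N));
          destruct (Nat.eqb_spec k (S N)); try lia; subst; simpl; ring.
      + now apply approximable_plus. }
  assert (H0 : approximable nu phi psi (coordinate beta 0)).
  { apply approximable_closed. intros eps He.
    (* The error [1 - V N / N] is the mean of [x, ..., x^N], whose energy is [N^(-2)] times a sum of
       weights. Using [N + 1 <= 2 N], it is at most [eps / 2 + 2 K / N], which is below [eps] when
       [4 K < N eps]. *)
    destruct (weight_sublinear nu Hnu (eps / 8)) as [K [HK Hw]]; [lra|].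
    destruct (archimed_nat eps (4 * K) He) as [N HN].
    assert (HN0 : 0 < INR N).
    { destruct (Rle_lt_dec (INR N) 0); [nra|assumption]. }
    assert (HN1 : 1 <= INR N) by (apply (le_INR 1 N); apply (INR_lt 0) in HN0; lia).
    exists (fun k => / INR N * V N k)%C. split; [apply approximable_scal, HV|].
    set (b := fun k => (coordinate beta 0 k - / INR N * V N k)%C).
    change (energy_le nu b eps).
    assert (Hb : forall k, Cmod (b k) <= / INR N).
    { intros k. unfold b, V, coordinate. pose proof (Rinv_0_lt_compat _ HN0).
      assert (HNC : RtoC (INR N) <> 0) by (intros Hc; apply RtoC_inj in Hc; lra).
      destruct (Nat.eqb_spec k 0).
      - subst k. replace (beta ^ 0 - / INR N * INR N)%C with (RtoC 0)
          by (simpl; field; exact HNC). rewrite Cmod_0. lra.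
      - destruct (Nat.leb k N).
        + replace (0 - / INR N * - beta ^ k)%C with (/ INR N * beta ^ k)%C by ring.
          rewrite Cmod_mult, Cmod_pow, Hbeta, pow1, Cmod_inv, Cmod_R, Rabs_pos_eq
            by (exact HNC || lra). lra.
        + replace (0 - / INR N * 0)%C with (RtoC 0) by ring. rewrite Cmod_0. lra. }
    intros n. eapply Rle_trans.
    { apply (sum_n_support_le _ N n); [apply energy_nonneg|].
      intros k Hk. unfold energy, b, V, coordinate.
      destruct (Nat.eqb_spec k 0); [lia|]. destruct (Nat.leb_spec k N); [lia|].
      replace (0 - / INR N * 0)%C with (RtoC 0) by ring. rewrite Cmod_0. ring. }
    apply Rle_trans with
      (sum_n (fun k => (/ INR N) ^ 2 * (eps / 8 * INR (k + 1) + K)) N).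
    { apply sum_n_le_compat. intros k. unfold energy.
      apply Rmult_le_compat; [apply pow2_ge_0|apply Rlt_le, weight_pos| |apply Hw].
      apply pow_incr. split; [apply Cmod_ge_0|apply Hb]. }
    rewrite sum_n_scal_R, sum_n_plus_R, sum_n_scal_R, sum_n_const, S_INR.
    pose proof (sum_n_INR_le N) as HI.
    apply Rle_trans with
      ((/ INR N) ^ 2 * (eps / 8 * (2 * INR N) ^ 2 + 2 * INR N * K)).
    { apply Rmult_le_compat_l; [apply pow2_ge_0|]. apply Rplus_le_compat.
      - apply Rmult_le_compat_l; [lra|]. eapply Rle_trans; [exact HI|].
        apply pow_incr. lra.
      - apply Rmult_le_compat_r; lra. }
    apply Rmult_le_reg_r with (INR N); [exact HN0|].
    replace ((/ INR N) ^ 2 * (eps / 8 * (2 * INR N) ^ 2 + 2 * INR N * K) * INR N)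
      with (eps / 2 * INR N + 2 * K) by (field; lra).
    lra. }
  assert (Hcoord : forall j, approximable nu phi psi (coordinate beta j)).
  { intros j. apply (approximable_ext _ _ _ (fun k =>
      coordinate beta 0 k - (coordinate beta 0 k - coordinate beta j k))%C).
    - intros k. ring.
    - now apply approximable_minus. }
  assert (Htrunc : forall N, approximable nu phi psi
    (fun k => if Nat.leb k N then a k else 0)).
  { assert (Hone : forall j, approximable nu phi psi
      (fun k => a j / beta ^ j * coordinate beta j k)%C).
    { intros j. apply approximable_scal, Hcoord. }
    assert (Hb0 : forall j, (beta ^ j)%C <> 0).
    { intros j. apply Cpow_nz. intros Hc. rewrite Hc, Cmod_0 in Hbeta. lra. }
    induction N as [|N IH].
    - refine (approximable_ext _ _ _ _ _ _ (Hone O)). intros k.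
      unfold coordinate. destruct k as [|k]; simpl; [field; exact C1_nz|ring].
    - refine (approximable_ext _ _ _ _ _ _
        (approximable_plus _ _ _ _ _ IH (Hone (S N)))).
      intros k. unfold coordinate.
      destruct (Nat.leb_spec k N); destruct (Nat.leb_spec k (S N));
        destruct (Nat.eqb_spec k (S N)); try lia; try ring.
      subst k. field. apply Hb0. }
  apply approximable_closed. intros eps He. destruct Hex as [l Hl].
  assert (Hlim : is_lim_seq (sum_n (energy nu a)) l) by exact Hl.
  apply is_lim_seq_spec in Hlim.
  destruct (Hlim (mkposreal eps He)) as [N HN].
  specialize (HN N (Nat.le_refl N)). simpl in HN. apply Rabs_def2 in HN.
  exists (fun k => if Nat.leb k N then a k else 0). split; [apply Htrunc|].
  set (tail := fun k => (a k - (if Nat.leb k N then a k else 0))%C).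
  change (energy_le nu tail eps). intros n.
  assert (Hsplit : forall m, sum_n (energy nu tail) (N + m)
    = sum_n (energy nu a) (N + m) - sum_n (energy nu a) N).
  { assert (Htail : forall k, (k <= N)%nat -> energy nu tail k = 0).
    { intros k Hk. unfold energy, tail. destruct (Nat.leb_spec k N); [|lia].
      replace (a k - a k)%C with (RtoC 0) by ring. rewrite Cmod_0. ring. }
    induction m as [|m IH].
    - rewrite Nat.add_0_r, Rminus_diag.
      rewrite (sum_n_ext_loc _ (fun _ => 0)) by exact Htail.
      rewrite sum_n_const. apply Rmult_0_r.
    - rewrite Nat.add_succ_r, !sum_Sn_R, IH.
      replace (energy nu tail (S (N + m))) with (energy nu a (S (N + m))); [lra|].
      unfold energy, tail. destruct (Nat.leb_spec (S (N + m)) N); [lia|].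
      do 3 f_equal. ring. }
  apply Rle_trans with (sum_n (energy nu tail) (N + n)).
  { apply sum_n_incr; [apply energy_nonneg|lia]. }
  rewrite Hsplit.
  pose proof (sum_n_le_is_series _ _ (N + n) (energy_nonneg nu a) Hl). lra.
Qed.

(** * Recurrence and conclusion *)

Lemma iter_cancel (phi psi : disk -> disk) (n : nat) (z : disk) :
  (forall z, psi (phi z) = z) -> Nat.iter n psi (Nat.iter n phi z) = z.
Proof.
  intros H. induction n as [|n IH]; [reflexivity|].
  now rewrite Nat.iter_succ_r, Nat.iter_succ, H.
Qed.

Lemma parabolic_recurrent (phi psi : disk -> disk) (alpha : C) (t nu : R) :
  (forall z, phi (psi z) = z) -> (forall z, psi (phi z) = z) ->
  Cmod alpha = 1 -> t <> 0 ->
  (forall z : disk, (cayley alpha (phi z) = cayley alpha z - t * Ci)%C) ->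
  nu < 1 / 2 -> recurrent nu (composition phi).
Proof.
  intros Hr Hl Hal Ht Hphi Hnu U [HU Hopen] [g Hg].
  pose proof (HU g Hg) as Hgd. pose proof Hgd as [[a Ha] _].
  pose proof (dirichlet_energy_bound nu g a Ha Hgd) as Hga.
  destruct (Hopen g Hg) as [eps [He Hball]].
  assert (Hpsi : forall z : disk,
    (cayley alpha (psi z) = cayley alpha z - (- t)%R * Ci)%C).
  { intros z. rewrite <- (Hr z) at 2. rewrite Hphi, RtoC_opp. ring. }
  assert (Happ : approximable nu phi psi a).
  { apply (approximable_all nu t alpha); try assumption.
    exists (dirichlet_norm nu g ^ 2). now apply dirichlet_energy_le. }
  (* Two errors of energy [d] add up to at most [2 d + 2 d = (eps / 2)^2], so the norm stays
     strictly below [eps]. *)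
  set (d := (eps / 2) ^ 2 / 4).
  assert (Hd : 0 < d) by (apply Rdiv_lt_0_compat; [apply pow_lt|]; lra).
  destruct (Happ d Hd) as [f [b [Hf1 [Hf2 [Hf3 Hf4]]]]].
  destruct (Hf1 d Hd) as [N1 HN1]. destruct (Hf2 d Hd) as [N2 HN2].
  (* Used for [h] the [n]-th composite of [f] with [psi], the starting point, and with [phi], its
     image. *)
  assert (Hclose : forall (h : disk -> C) (c : nat -> C),
    power_expansion h c -> energy_le nu c d -> U (fun z => f z + h z)%C).
  { intros h c Hh Hc.
    assert (Hexp : power_expansion (fun z => f z + h z - g z)%C
      (fun k => b k + c k - a k)%C).
    { apply power_expansion_minus; [now apply power_expansion_plus|exact Ha]. }
    assert (HE : energy_le nu (fun k => b k + c k - a k)%C ((eps / 2) ^ 2)).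
    { replace ((eps / 2) ^ 2) with (2 * (Cmod (-(1)) ^ 2 * d) + 2 * d)
        by (rewrite Cmod_m1; unfold d; field).
      refine (energy_le_ext _ _ _ _ _
        (energy_le_plus _ _ _ _ _ (energy_le_scal _ (-(1)) _ _ Hf4) Hc)).
      intros k. simpl. ring. }
    destruct (energy_le_dirichlet nu _ _ _ Hexp HE) as [_ Hnorm].
    rewrite sqrt_pow2 in Hnorm by lra.
    apply Hball; [|lra].
    apply (energy_le_dirichlet nu _ (fun k => b k + c k)%C
      (2 * (dirichlet_norm nu g ^ 2) + 2 * (eps / 2) ^ 2)).
    - now apply power_expansion_plus.
    - refine (energy_le_ext _ _ _ _ _ (energy_le_plus _ _ _ _ _ Hga HE)).
      intros k. simpl. ring. }
  set (n := S (Nat.max N1 N2)).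
  destruct (HN1 n) as [c1 [Hc1 Ec1]]; [lia|].
  destruct (HN2 n) as [c2 [Hc2 Ec2]]; [lia|].
  exists n. split; [lia|].
  exists (fun z => f z + f (Nat.iter n psi z))%C. split.
  - exact (Hclose _ c2 Hc2 Ec2).
  - rewrite iter_composition.
    replace (fun z => (f (Nat.iter n phi z) + f (Nat.iter n psi (Nat.iter n phi z)))%C)
      with (fun z => (f z + f (Nat.iter n phi z))%C).
    + exact (Hclose _ c1 Hc1 Ec1).
    + apply functional_extensionality. intros z.
      rewrite (iter_cancel phi psi n z Hl). ring.
Qed.

Theorem theorem2p4 (phi : disk -> disk) (nu : R) (hphi : parabolic_automorphism phi) :
  recurrent nu (composition phi) <-> nu < 1 / 2.
Proof.
  destruct (parabolic_automorphism_normal_form phi hphi)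
    as [psi [alpha [t [Hr [Hl [Hal [Ht Hphi]]]]]]].
  split.
  - intros Hrec. apply Rnot_le_lt. intros Hnu.
    exact (parabolic_not_recurrent phi alpha t nu Hal Ht Hphi Hnu Hrec).
  - exact (parabolic_recurrent phi psi alpha t nu Hr Hl Hal Ht Hphi).
Qed.
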